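(* Let $i,j\in I$ be vertices such that there is no arrow from $j$ to $i$, and let $n$ be the number of arrows from $i$ to $j$. Given integers $1\le k\le n$ and $x\ge k$, define $p(k,x)$ as the least integer greater than or equal to $(n-\frac1k)x$. Then in $\mathcal{C}(Q)$ one has $$R_{\sigma_i}*R_{\sigma_j}^{*k}*R_{\sigma_i}^{*x}*R_{\sigma_j}^{*p(k,x)}=R_{\sigma_i}^{*(x+1)}*R_{\sigma_j}^{*(p(k,x)+k)}.$$
   Context: The ground field $K$ is algebraically closed of characteristic $0$, and $Q$ is a finite quiver without oriented cycles with vertex set $I$. $\mathbf{N}I$ is the set of vectors with nonnegative integer coordinates in the free abelian group on symbols $\sigma_i$ ($i\in I$). For $d\in\mathbf{N}I$, $R_d=\bigoplus_{\alpha:a\to b}\mathrm{Hom}_K(K^{d_a},K^{d_b})$ is the affine variety of representations of $Q$ of dimension vector $d$. For $\mathcal{A}\subset R_d$, $\mathcal{B}\subset R_e$, the set $\mathcal{A}*\mathcal{B}\subset R_{d+e}$ consists of all $X\in R_{d+e}$ for which there is an exact sequence of representations $0\to N\to X\to M\to 0$ with $M\in\mathcal{A}$, $N\in\mathcal{B}$. This operation is associative, and $\mathcal{A}^{*m}$ denotes the $m$-fold product of $\mathcal{A}$ with itself (with $\mathcal{A}^{*0}=R_0$, the unit). The composition monoid $\mathcal{C}(Q)$ is the monoid, under $*$, generated by the $R_{\sigma_i}$, $i\in I$. *)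

(* Defs.v *)
From HB Require Import structures.
From mathcomp Require Import all_boot all_order all_algebra.
From mathcomp Require Import boolp classical_sets.

Set Implicit Arguments.
Unset Strict Implicit.
Unset Printing Implicit Defensive.

Import Order.TTheory GRing.Theory Num.Theory.
Local Open Scope ring_scope.

Record quiver := Quiver {
  vertex : finType;
  arrow : finType;
  src : arrow -> vertex;
  tgt : arrow -> vertex
}.

(* [path.cycle] accepts the empty sequence, hence the conclusion. *)
Definition acyclic (Q : quiver) :=
  forall c : seq (arrow Q), cycle (fun a b => tgt a == src b) c -> c = [::].

Definition narrows (Q : quiver) (i j : vertex Q) : nat :=
  #|[pred a : arrow Q | (src a == i) && (tgt a == j)]|.

Notation dimvec Q := {ffun vertex Q -> nat}.

Definition simple_dim (Q : quiver) (i : vertex Q) : dimvec Q :=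
  [ffun v => nat_of_bool (v == i)].

Section MatrixExactness.
Variable K : fieldType.

(* 0 -> K^n -> K^x -> K^m -> 0, with matrices acting on row vectors. *)
Definition mx_exact n x m (f : 'M[K]_(n, x)) (g : 'M[K]_(x, m)) :=
  [/\ row_free f, row_full g & (f == kermx g)%MS].

Lemma mx_exact_mul0 n x m (f : 'M[K]_(n, x)) (g : 'M_(x, m)) :
  mx_exact f g -> f *m g = 0.
Proof. by case=> _ _ /andP[/sub_kermxP]. Qed.

Lemma mx_exact_dim n x m (f : 'M[K]_(n, x)) (g : 'M_(x, m)) :
  mx_exact f g -> (n + m)%N = x.
Proof.
case=> /eqP rf /eqP rg /eqmx_rank; rewrite mxrank_ker rf rg => ->.
by rewrite subnK // -[leqLHS]rg rank_leq_row.
Qed.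

Lemma mx_exactI n x m (f : 'M[K]_(n, x)) (g : 'M_(x, m)) :
  row_free f -> row_full g -> f *m g = 0 -> (n + m)%N = x -> mx_exact f g.
Proof.
move=> rf rg /sub_kermxP fg nmx; split=> //.
rewrite -(mxrank_leqif_eq fg) mxrank_ker.
by move: rf rg => /eqP-> /eqP->; rewrite -nmx addnK.
Qed.

Lemma mx_exact_lift n x m p (f : 'M[K]_(n, x)) (g : 'M_(x, m)) (h : 'M_(p, x)) :
  mx_exact f g -> h *m g = 0 -> h *m pinvmx f *m f = h.
Proof.
case=> _ _ /andP[_ sgf] /sub_kermxP hg.
by rewrite mulmxKpV // (submx_trans hg).
Qed.

Lemma mx_exact_desc n x m p (f : 'M[K]_(n, x)) (g : 'M_(x, m)) (h : 'M_(x, p)) :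
  mx_exact f g -> f *m h = 0 -> g *m (pinvmx g *m h) = h.
Proof.
move=> fg fh; have [_ rg _] := fg.
have: (g *m pinvmx g - 1%:M) *m g = 0.
  by rewrite mulmxBl -mulmxA mulVpmx // mulmx1 mul1mx subrr.
move=> /(mx_exact_lift fg) e; apply/eqP; rewrite -subr_eq0 mulmxA.
rewrite -{2}[h]mul1mx -mulmxBl -e.
by rewrite -(mulmxA _ f h) fh mulmx0.
Qed.

Lemma ex_mx_ker n x m (g : 'M[K]_(x, m)) :
  row_full g -> (n + m)%N = x -> exists f : 'M[K]_(n, x), mx_exact f g.
Proof.
move=> rg nmx.
have: n = \rank (kermx g) by rewrite mxrank_ker (eqP rg) -nmx addnK.
move=> ?; subst n; exists (row_base (kermx g)); split=> //.
  exact: row_base_free.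
by apply/eqmxP/eq_row_base.
Qed.

Lemma ex_mx_coker n x m (f : 'M[K]_(n, x)) :
  row_free f -> (n + m)%N = x -> exists g : 'M[K]_(x, m), mx_exact f g.
Proof.
move=> rf nmx.
have: m = \rank (cokermx f) by rewrite mxrank_coker (eqP rf) -nmx addKn.
move=> ?; subst m; exists (col_base (cokermx f)).
apply: mx_exactI => //; first exact: col_base_full.
apply: (row_free_inj (row_base_free (cokermx f))).
by rewrite -mulmxA mulmx_base mulmx_coker mul0mx.
Qed.

Lemma row_freeM n x m (f : 'M[K]_(n, x)) (g : 'M_(x, m)) :
  row_free f -> row_free g -> row_free (f *m g).
Proof. by move=> rf rg; rewrite /row_free mxrankMfree. Qed.

Lemma row_fullM n x m (f : 'M[K]_(n, x)) (g : 'M_(x, m)) :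
  row_full f -> row_full g -> row_full (f *m g).
Proof.
move=> /row_fullP[f' ff] /row_fullP[g' gg]; apply/row_fullP.
by exists (g' *m f'); rewrite mulmxA -(mulmxA g') ff mulmx1.
Qed.

Lemma row_free0 n x (f : 'M[K]_(n, x)) :
  (forall u : 'rV_n, u *m f = 0 -> u = 0) -> row_free f.
Proof.
move=> inj; rewrite -kermx_eq0; apply/eqP/row_matrixP => k.
by rewrite row0; apply: inj; apply/sub_kermxP/row_sub.
Qed.

End MatrixExactness.

Section Representations.
Variables (K : fieldType) (Q : quiver).
Implicit Types d e : dimvec Q.

(* A matrix acts on row vectors, [v |-> v *m X a], so that [X a] is the linear
   map from the space at the source of [a] to the space at its target. *)
Definition rep d : Type := forall a : arrow Q, 'M[K]_(d (src a), d (tgt a)).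

Definition is_hom d e (M : rep d) (N : rep e)
    (f : forall v, 'M[K]_(d v, e v)) :=
  forall a, M a *m f (tgt a) = f (src a) *m N a.

(* There is an exact sequence 0 -> N -> X -> M -> 0 of representations. *)
Definition short_exact dN dX dM (N : rep dN) (X : rep dX) (M : rep dM) :=
  exists (f : forall v, 'M[K]_(dN v, dX v)) (g : forall v, 'M[K]_(dX v, dM v)),
    [/\ is_hom N X f, is_hom X M g & forall v, mx_exact (f v) (g v)].

Definition star_set d e (A : set (rep d)) (B : set (rep e)) :
    set (rep (d + e)) :=
  fun X => exists (M : rep d) (N : rep e), [/\ A M, B N & short_exact N X M].

(* A dimension vector [d] together with a subset of [rep d].  Equality in this
   type means equality of the dimension vectors and of the subsets; it makes
   sense of equations between products whose dimension vectors are equal but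
   not convertible. *)
Definition repset := {d : dimvec Q & set (rep d)}.

Definition full_repset d : repset :=
  Tagged (fun d => set (rep d)) (@setT (rep d)).

Definition star (A B : repset) : repset :=
  Tagged (fun d => set (rep d)) (star_set (tagged A) (tagged B)).

Inductive generated : repset -> Prop :=
| generated_unit : generated (full_repset 0)
| generated_simple i : generated (full_repset (simple_dim i))
| generated_star A B : generated A -> generated B -> generated (star A B).

(* [inset A X]: the representation [X], of a dimension vector not known to be
   that of [A], lies in [A]. *)
Definition inset (A : repset) d (X : rep d) :=
  exists2 Y : rep (tag A), tagged A Y & Tagged rep X = Tagged rep Y.

Lemma insetE (A : repset) (X : rep (tag A)) : inset A X <-> tagged A X.
Proof.
split=> [[Y AY eXY]|AX]; last by exists X.
by rewrite (eq_from_Tagged eXY).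
Qed.
Arguments insetE : clear implicits.

Lemma inset_dim (A : repset) d (X : rep d) : inset A X -> tag A = d.
Proof. by case=> Y _ /(congr1 tag). Qed.

Lemma inset_ind (A : repset) d (X : rep d)
    (P : forall d, rep d -> Prop) :
  (forall Y, tagged A Y -> P _ Y) -> inset A X -> P d X.
Proof.
move=> PA /[dup]/inset_dim ed; subst d; move=> /insetE; exact: PA.
Qed.

Lemma repset_eq (A B : repset) : tag A = tag B ->
  (forall d (X : rep d), inset A X <-> inset B X) -> A = B.
Proof.
case: A B => d A [e B] /= ed; subst e => AB; congr existT.
apply/predeqP => X; have := AB d X.
by rewrite (insetE (Tagged (fun d => set (rep d)) A))
  (insetE (Tagged (fun d => set (rep d)) B)).
Qed.

Lemma short_exact_dim dN dX dM (N : rep dN) (X : rep dX) (M : rep dM) :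
  short_exact N X M -> dX = dM + dN.
Proof.
case=> f [g [_ _ fg]]; apply/ffunP => v.
by rewrite ffunE -(mx_exact_dim (fg v)); exact: addnC.
Qed.

Lemma inset_starP (A B : repset) d (X : rep d) :
  inset (star A B) X <->
  exists dM dN (M : rep dM) (N : rep dN),
    [/\ inset A M, inset B N & short_exact N X M].
Proof.
split.
  apply: (@inset_ind _ _ _ (fun d X => exists dM dN (M : rep dM) (N : rep dN),
    [/\ inset A M, inset B N & short_exact N X M])) => Y [M [N [AM BN E]]].
  by exists (tag A), (tag B), M, N; split=> //; apply/insetE.
case=> dM [dN [M [N [AM BN E]]]].
have eM := inset_dim AM; have eN := inset_dim BN.
subst dM dN; have ed := short_exact_dim E; subst d.
by apply/(insetE (star A B)); exists M, N; split=> //; apply/insetE.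
Qed.

Definition iso d e (M : rep d) (N : rep e) :=
  exists2 f : forall v, 'M[K]_(d v, e v), is_hom M N f
    & forall v, row_free (f v) && row_full (f v).

Definition iso_closed (A : repset) :=
  forall d e (M : rep d) (N : rep e), iso M N -> inset A M -> inset A N.

Lemma iso_dim d e (M : rep d) (N : rep e) : iso M N -> d = e.
Proof.
case=> f _ ff; apply/ffunP => v; have /andP[/eqP rf] := ff v.
by rewrite /row_full rf => /eqP.
Qed.

Lemma iso_sym d e (M : rep d) (N : rep e) : iso M N -> iso N M.
Proof.
move=> /[dup] /iso_dim ed; subst e; case=> f hf ff.
have uf v : f v \in unitmx by rewrite -row_free_unit; case/andP: (ff v).
exists (fun v => invmx (f v)) => [a|v].
  by rewrite -[N a](mulKmx (uf (src a))) -hf -!mulmxA mulmxV // mulmx1.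
by rewrite row_free_unit row_full_unit unitmx_inv uf.
Qed.

Lemma hom_comp d1 d2 d3 (X : rep d1) (Y : rep d2) (Z : rep d3) f g :
  is_hom X Y f -> is_hom Y Z g -> is_hom X Z (fun v => f v *m g v).
Proof. by move=> hf hg a; rewrite mulmxA hf -mulmxA hg mulmxA. Qed.

Lemma hom_desc d1 d2 d3 (X : rep d1) (Y : rep d2) (Z : rep d3) f g h :
    is_hom X Y f -> is_hom X Z h -> (forall v, row_full (f v)) ->
  (forall v, f v *m g v = h v) -> is_hom Y Z g.
Proof.
move=> hf hh ff fg a; apply: (row_full_inj (ff (src a))).
by rewrite !mulmxA -hf -mulmxA !fg.
Qed.

Lemma hom_lift d1 d2 d3 (X : rep d1) (Y : rep d2) (Z : rep d3) f g h :
    is_hom Y Z f -> is_hom X Z h -> (forall v, row_free (f v)) ->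
  (forall v, g v *m f v = h v) -> is_hom X Y g.
Proof.
move=> hf hh ff fg a; apply: (row_free_inj (ff (tgt a))).
by rewrite -!mulmxA hf fg mulmxA fg.
Qed.

Lemma ex_ker n x m (X : rep x) (M : rep m) g :
    is_hom X M g -> (forall v, row_full (g v)) -> x = m + n ->
  exists (N : rep n) f, is_hom N X f /\ forall v, mx_exact (f v) (g v).
Proof.
move=> hg fg ex.
have exf v : exists f : 'M_(n v, x v), mx_exact f (g v).
  by apply: ex_mx_ker => //; rewrite ex ffunE; exact: addnC.
pose f v := projT1 (cid (exf v)); have fP v : mx_exact (f v) (g v) := projT2 (cid (exf v)).
exists (fun a => f (src a) *m X a *m pinvmx (f (tgt a))), f; split=> // a.
apply: (mx_exact_lift (fP _)).
by rewrite -mulmxA hg mulmxA (mx_exact_mul0 (fP _)) mul0mx.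
Qed.

Lemma ex_coker n x m (N : rep n) (X : rep x) f :
    is_hom N X f -> (forall v, row_free (f v)) -> x = m + n ->
  exists (M : rep m) g, is_hom X M g /\ forall v, mx_exact (f v) (g v).
Proof.
move=> hf ff ex.
have exg v : exists g : 'M_(x v, m v), mx_exact (f v) g.
  by apply: ex_mx_coker => //; rewrite ex ffunE; exact: addnC.
pose g v := projT1 (cid (exg v)); have gP v : mx_exact (f v) (g v) := projT2 (cid (exg v)).
exists (fun a => pinvmx (g (src a)) *m (X a *m g (tgt a))), g; split=> // a.
apply/esym/(mx_exact_desc (gP _)).
by rewrite mulmxA -hf -mulmxA (mx_exact_mul0 (gP _)) mulmx0.
Qed.

Lemma starA A B C : star A (star B C) = star (star A B) C.
Proof.
apply: repset_eq => [|d X]; first exact: addrA.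
split=> /inset_starP.
- case=> dM [dN [M [N [AM /inset_starP[dP [dR [P [R [BP CR eN]]]]] eX]]]].
  have edX := short_exact_dim eX; have edN := short_exact_dim eN.
  have [i [p [hi hp ip]]] := eX; have [j [q [hj hq jq]]] := eN.
  have fi v : row_free (i v) by case: (ip v).
  have fj v : row_free (j v) by case: (jq v).
  have fp v : row_full (p v) by case: (ip v).
  have fq v : row_full (q v) by case: (jq v).
  have [Y [s [hs js]]] := @ex_coker _ _ (dM + dP) _ _ _ (hom_comp hj hi)
    (fun v => row_freeM (fj v) (fi v)) ltac:(by rewrite edX edN addrA).
  have fs v : row_full (s v) by case: (js v).
  apply/inset_starP; exists (dM + dP), dR, Y, R; split=> //; last first.
    by exists (fun v => j v *m i v), s; split=> //; exact: hom_comp hj hi.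
  apply/inset_starP; exists dM, dP, M, P; split=> //.
  pose h v := pinvmx (s v) *m p v; pose u v := pinvmx (q v) *m (i v *m s v).
  have sh v : s v *m h v = p v.
    apply: (mx_exact_desc (js v)).
    by rewrite -mulmxA (mx_exact_mul0 (ip v)) mulmx0.
  have qu v : q v *m u v = i v *m s v.
    apply: (mx_exact_desc (jq v)).
    by rewrite mulmxA (mx_exact_mul0 (js v)).
  exists u, h; split=> [||v].
  + exact: (hom_desc hq (hom_comp hi hs) fq qu).
  + exact: (hom_desc hs hp fs sh).
  + apply: mx_exactI.
    * apply: row_free0 => w wu.
      have /row_fullP[q' qq] := fq v.
      have /(mx_exact_lift (js v)) : w *m q' *m i v *m s v = 0.
        by rewrite -!mulmxA -qu (mulmxA q') qq mul1mx.
      rewrite mulmxA => /(row_free_inj (fi v)) e.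
      by rewrite -[w]mulmx1 -qq mulmxA -e -mulmxA (mx_exact_mul0 (jq v)) mulmx0.
    * have /row_fullP[p' pp] := fp v; apply/row_fullP.
      by exists (p' *m s v); rewrite -mulmxA sh.
    * apply: (row_full_inj (fq v)).
      by rewrite mulmxA qu -mulmxA sh mulmx0 (mx_exact_mul0 (ip v)).
    * by rewrite ffunE; exact: addnC.
- case=> dY [dR [Y [R [/inset_starP[dM [dP [M [P [AM BP eY]]]]] CR eX]]]].
  have edX := short_exact_dim eX; have edY := short_exact_dim eY.
  have [k [s [hk hs ks]]] := eX; have [u [h [hu hh uh]]] := eY.
  have fk v : row_free (k v) by case: (ks v).
  have fs v : row_full (s v) by case: (ks v).
  have fu v : row_free (u v) by case: (uh v).
  have fh v : row_full (h v) by case: (uh v).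
  have [N [i [hi ip]]] := @ex_ker (dP + dR) _ _ _ _ _ (hom_comp hs hh)
    (fun v => row_fullM (fs v) (fh v)) ltac:(by rewrite edX edY addrA).
  have fi v : row_free (i v) by case: (ip v).
  apply/inset_starP; exists dM, (dP + dR), M, N; split=> //; last first.
    by exists i, (fun v => s v *m h v); split=> //; exact: hom_comp hs hh.
  apply/inset_starP; exists dP, dR, P, R; split=> //.
  pose j v := k v *m pinvmx (i v); pose q v := i v *m s v *m pinvmx (u v).
  have ji v : j v *m i v = k v.
    apply: (mx_exact_lift (ip v)).
    by rewrite mulmxA (mx_exact_mul0 (ks v)) mul0mx.
  have qu v : q v *m u v = i v *m s v.
    apply: (mx_exact_lift (uh v)).
    by rewrite -mulmxA (mx_exact_mul0 (ip v)).
  exists j, q; split=> [||v].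
  + exact: (hom_lift hi hk fi ji).
  + exact: (hom_lift hu (hom_comp hi hs) fu qu).
  + apply: mx_exactI.
    * by apply: row_free0 => w wj; apply: (row_free_inj (fk v));
        rewrite -ji mulmxA wj !mul0mx.
    * have /row_fullP[s' ss] := fs v.
      have /(mx_exact_lift (ip v)) e : u v *m s' *m (s v *m h v) = 0.
        by rewrite mulmxA -(mulmxA (u v)) ss mulmx1 (mx_exact_mul0 (uh v)).
      apply/row_fullP; exists (u v *m s' *m pinvmx (i v)).
      apply: (row_free_inj (fu v)).
      by rewrite -mulmxA qu mulmxA e -mulmxA ss mulmx1 mul1mx.
    * apply: (row_free_inj (fu v)).
      by rewrite -mulmxA qu mulmxA ji mul0mx (mx_exact_mul0 (ks v)).
    * by rewrite ffunE; exact: addnC.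
Qed.

Lemma full_iso_closed d : iso_closed (full_repset d).
Proof.
move=> d1 d2 M N /iso_dim ed; subst d2 => /[dup] /inset_dim /= ed _; subst d1.
exact/(insetE (full_repset d)).
Qed.

Lemma star_iso_closed A B : iso_closed (star A B).
Proof.
move=> d1 d2 X Y XY; have [s hs fs] := iso_sym XY; case: XY => r hr fr.
move=> /inset_starP[dM [dN [M [N [AM BN eX]]]]].
have [f [g [hf hg fg]]] := eX; have edX := short_exact_dim eX.
have ed := iso_dim (ex_intro2 _ _ r hr fr); subst d2.
have ur v : r v \in unitmx by rewrite -row_free_unit; case/andP: (fr v).
apply/inset_starP; exists dM, dN, M, N; split=> //.
have frf v : row_free (f v *m r v).
  by case: (fg v) (fr v) => ff _ _ /andP[rr _]; exact: row_freeM.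
have fig v : row_full (invmx (r v) *m g v).
  case: (fg v) => _ gf _; apply: row_fullM => //.
  by rewrite row_full_unit unitmx_inv.
exists (fun v => f v *m r v), (fun v => invmx (r v) *m g v).
split=> [||v]; first exact: hom_comp hf hr.
  apply: (hom_desc hr hg) => v; first by case/andP: (fr v).
  by rewrite mulKVmx.
apply: mx_exactI => //.
  by rewrite mulmxA mulmxK ?(mx_exact_mul0 (fg v)).
by rewrite edX ffunE; exact: addnC.
Qed.

Lemma generated_iso_closed A : generated A -> iso_closed A.
Proof.
case=> [|i|B C _ _]; [exact: full_iso_closed|exact: full_iso_closed|].
exact: star_iso_closed.
Qed.

Lemma star1 A : iso_closed A -> star (full_repset 0) A = A.
Proof.
move=> iA; apply: repset_eq => [|d X]; first exact: add0r.
split=> [/inset_starP|AX].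
  case=> dM [dN [M [N [/inset_dim /= e0 AN eX]]]]; subst dM.
  apply: iA AN; case: eX => f [g [hf _ fg]]; exists f => // v.
  have [rf _ _] := fg v; rewrite rf /row_full (eqP rf).
  by have := mx_exact_dim (fg v); rewrite ffunE addn0 => ->; rewrite eqxx.
apply/inset_starP; exists 0, d, (fun=> 0), X; split=> //.
  exact/(insetE (full_repset 0)).
exists (fun=> 1%:M), (fun=> 0); split=> [a|a|v].
- by rewrite mulmx1 mul1mx.
- by rewrite mulmx0 mul0mx.
- apply: mx_exactI; rewrite ?row_free_unit ?unitmx1 ?mulmx0 //.
    by rewrite /row_full mxrank0 ffunE.
  by rewrite ffunE addn0.
Qed.

Lemma mulr_star1 A : iso_closed A -> star A (full_repset 0) = A.
Proof.
move=> iA; apply: repset_eq => [|d X]; first exact: addr0.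
split=> [/inset_starP|AX].
  case=> dM [dN [M [N [AM /inset_dim /= e0 eX]]]]; subst dN.
  apply: iA AM; apply: iso_sym.
  case: eX => f [g [_ hg fg]]; exists g => // v.
  have [_ rg _] := fg v; rewrite rg andbT /row_free (eqP rg).
  by have := mx_exact_dim (fg v); rewrite ffunE add0n => ->; rewrite eqxx.
apply/inset_starP; exists d, 0, X, (fun=> 0); split=> //.
  exact/(insetE (full_repset 0)).
exists (fun=> 0), (fun=> 1%:M); split=> [a|a|v].
- by rewrite mulmx0 mul0mx.
- by rewrite mulmx1 mul1mx.
- apply: mx_exactI; rewrite ?row_full_unit ?unitmx1 ?mul0mx //.
    by rewrite /row_free mxrank0 ffunE.
  by rewrite ffunE add0n.
Qed.

(* The elements of the composition monoid C(Q).  [full_repset 0] is neutral for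
   [star] only on sets closed under isomorphism, so the monoid laws hold on
   [comp_monoid] but not on [repset]. *)
Record comp_monoid := CompMonoid {
  comp_val : repset;
  comp_valP : generated comp_val
}.

Lemma comp_val_inj : injective comp_val.
Proof.
by move=> [A hA] [B hB] /= eAB; subst B; rewrite (Prop_irrelevance hA hB).
Qed.

Definition comp_one := CompMonoid generated_unit.

Definition comp_mul x y :=
  CompMonoid (generated_star (comp_valP x) (comp_valP y)).

Fact comp_mulA : associative comp_mul.
Proof. by move=> x y z; apply: comp_val_inj; exact: starA. Qed.

Fact comp_mul1 : left_id comp_one comp_mul.
Proof.
by move=> x; apply/comp_val_inj/star1/generated_iso_closed/comp_valP.
Qed.

Fact comp_mulr1 : right_id comp_one comp_mul.
Proof.
by move=> x; apply/comp_val_inj/mulr_star1/generated_iso_closed/comp_valP.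
Qed.

HB.instance Definition _ := gen_eqMixin comp_monoid.
HB.instance Definition _ := gen_choiceMixin comp_monoid.
HB.instance Definition _ :=
  isMonoid.Build comp_monoid comp_mulA comp_mul1 comp_mulr1.

Definition comp_simple (i : vertex Q) : comp_monoid :=
  CompMonoid (generated_simple i).

End Representations.

(* [Num.ceil] is an [int]; it is nonnegative for 1 <= k <= n, so that [absz]
   only changes its type. *)
Definition pkx (n k x : nat) : nat :=
  absz (Num.ceil ((n%:R - k%:R^-1) * x%:R : rat)).

(* Main.v *)
Require Import Defs.
From HB Require Import structures.
From mathcomp Require Import all_boot all_order all_algebra.
From mathcomp Require Import perm mpoly zify.
From mathcomp Require Import boolp.

Set Implicit Arguments.
Unset Strict Implicit.
Unset Printing Implicit Defensive.

Import Order.TTheory GRing.Theory Num.Theory.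
Local Open Scope ring_scope.

(** Since there is no arrow from [j] to [i] and no loop, [R_i^a * R_j^b] is the
    set of all representations of dimension [a i + b j].  Both sides of the
    identity therefore have the same dimension vector, and the identity says
    that every representation [X] of dimension [(x+1) i + (p+k) j] has a
    quotient of dimension [i + k j] ([star_full_Kronecker]).

    Such an [X] consists of [n] linear maps [A_t] from [K^(x+1)] to [K^(p+k)].
    A quotient of the required dimension is a nonzero functional [v] on
    [K^(x+1)] together with [k] independent functionals on [K^(p+k)] whose
    composites with every [A_t] are multiples of [v].  Collect the transposes of
    the [A_t] into one map [B] from the dual of [K^(p+k)] to [K^n (x) U], where
    [U] is the dual of [K^(x+1)], and let [C] be the cokernel of [B].  What is
    needed is a [v] such that the preimage under [B] of [K^n (x) v] has
    dimension at least [k]; for an injective [B] this says that the map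
    [c |-> c (x) v] from [K^n] to [C] has rank at most [n - k].  Here
    [dim C = n + r - k] with [r = n x - p], so that matrices of rank at most
    [n - k] have codimension [k r] among all [n] by [n + r - k] matrices; as
    [k r <= x] by the choice of [p], a linear family with [x + 1] parameters
    must meet them outside [0].  A kernel of [B] only helps
    ([common_quotient]).

    It remains to show that a linear family of [a] by [b] matrices with more
    than [(a - s) (b - s)] parameters contains a nonzero matrix of rank at most
    [s], or has a kernel ([low_rank_in_linear_family]).  This is the projective
    dimension theorem for the determinantal cone, proved here for any cone
    ([linear_section_of_cone]): if [D] of the coordinates are algebraically
    independent on the cone and fewer than [D] linear equations are imposed,
    then the homogeneous equations of the cone keep a nonzero common zero.

    Let [S] be the graded polynomial ring and [J] the graded ideal of the cone.
    - Adding one linear form lowers the growth of the Hilbert function by at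
      most one degree ([codim_growth]).  The Hilbert function of [S/J] dominates
      that of a polynomial ring in [D] variables, so adding fewer than [D]
      linear forms leaves a quotient that is nonzero in every degree.
    - A graded quotient that is nonzero in every degree has a point
      ([never_full_common_zero]), which is the projective Nullstellensatz.
      Enlarge the space [H] of linear forms that have been added until no
      further form can be added.  Then any [l] outside [H] acts surjectively,
      hence eventually bijectively, on the quotient.  Were there two forms [l],
      [y] independent modulo [H], an eigenvalue [a] of [l^-1 y] would make
      [y - a l] act non-injectively, a contradiction ([maximal_hyperplane]).
      So [H] is a hyperplane: the forms vanishing at a point. *)

(** * Singular members of pencils of maps between quotients *)

Lemma quotient_coordinates (K : fieldType) (V : vectType K) (U : {vspace V}) r :
  (\dim U + r)%N = dim V ->
  exists q : 'Hom(V, 'rV[K]_r), lker q = U /\ limg q = fullv.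
Proof.
move=> dimU; have rE : r = \dim (U^C)%VS by rewrite dimv_compl dimvf -dimU addKn.
subst r.
have UC : (U^C :&: U = 0)%VS by rewrite capvC capv_compl.
pose q (x : V) : 'rV_(\dim (U^C)%VS) :=
  \row_i coord (vbasis (U^C)%VS) i (daddv_pi (U^C)%VS U x).
have q_lin : linear q.
  by move=> a x y; apply/rowP => i; rewrite !mxE !linearP.
pose Q := linfun (HB.pack_for {linear V -> 'rV[K]_(\dim (U^C)%VS)} q
  (GRing.isLinear.Build K V 'rV[K]_(\dim (U^C)%VS) *:%R q q_lin)).
have kerQ : lker Q = U.
  apply/vspaceP => x; rewrite memv_ker lfunE /=; apply/eqP/idP => [q0|xU].
    have pi0 : daddv_pi (U^C)%VS U x = 0.
      rewrite (coord_vbasis (memv_pi (U^C)%VS U x)) big1 // => i _.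
      by have /rowP/(_ i) := q0; rewrite !mxE => ->; rewrite scale0r.
    have := @daddv_pi_add _ _ (U^C)%VS U x UC.
    rewrite pi0 add0r => <-; rewrite ?memv_pi //.
    by rewrite addvC addv_complf memvf.
  apply/rowP => i; rewrite !mxE.
  suff -> : daddv_pi (U^C)%VS U x = 0 by rewrite linear0.
  have := @daddv_pi_add _ _ (U^C)%VS U x UC.
  rewrite (@daddv_pi_id _ _ U (U^C)%VS) ?capv_compl //.
  rewrite addvC addv_complf memvf => /(_ isT).
  by move/(canRL (addrK _)); rewrite subrr.
exists Q; split=> //; apply/eqP; rewrite eqEdim subvf dimvf /=.
have := limg_ker_dim Q fullv; rewrite kerQ capfv dimvf -dimU.
by move/eqP; rewrite eqn_add2l => /eqP ->; rewrite dim_matrix mul1r.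
Qed.

(** In terms of the maps [V1/U1 -> V2/U2] that [f] and [g] are meant to induce,
    [f] is an isomorphism of nonzero spaces and [a] is an eigenvalue of
    [f^-1 g].  As [f] and [g] may move [U1] out of [U2], a linear section of
    [V1 -> V1/U1] is used to replace the induced maps. *)
Lemma pencil_degenerate (K : closedFieldType) (V1 V2 : vectType K)
    (U1 : {vspace V1}) (U2 : {vspace V2}) (f g : 'Hom(V1, V2)) :
  U1 <> fullv -> (dim V1 - \dim U1 = dim V2 - \dim U2)%N ->
  (forall x, f x \in U2 -> x \in U1) ->
  exists a x, x \notin U1 /\ g x - a *: f x \in U2.
Proof.
move=> nfull eqr f_inj.
have [r dim1] : exists r, (\dim U1 + r.+1 = dim V1)%N.
  have := dimvS (subvf U1); rewrite dimvf leq_eqVlt => /predU1P[e|lt].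
    by case: nfull; apply/eqP; rewrite eqEdim subvf dimvf e leqnn.
  by exists (dim V1 - \dim U1).-1; rewrite prednK ?subn_gt0 // subnKC // ltnW.
have dim2 : (\dim U2 + r.+1 = dim V2)%N.
  have := dimvS (subvf U2); rewrite dimvf => le2.
  by rewrite -dim1 addKn in eqr; rewrite eqr subnKC.
have [q1 [ker1 img1]] := quotient_coordinates dim1.
have [q2 [ker2 _]] := quotient_coordinates dim2.
pose a := lin1_mx (q2 \o f \o q1^-1)%VF; pose b := lin1_mx (q2 \o g \o q1^-1)%VF.
have q1K (v : 'rV_r.+1) : q1 (q1^-1%VF v) = v by rewrite limg_lfunVK // img1 memvf.
have aE v : v *m a = q2 (f (q1^-1%VF v)) by rewrite mul_rV_lin1 /= !comp_lfunE.
have bE v : v *m b = q2 (g (q1^-1%VF v)) by rewrite mul_rV_lin1 /= !comp_lfunE.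
have ua : a \in unitmx.
  rewrite -row_free_unit -kermx_eq0; apply/eqP/row_matrixP => i; rewrite row0.
  have : row i (kermx a) *m a = 0 by rewrite -row_mul mulmx_ker row0.
  rewrite aE => /eqP; rewrite -memv_ker ker2 => /f_inj.
  by rewrite -ker1 memv_ker q1K => /eqP.
have [t] : exists t, root (char_poly (b *m invmx a)) t.
  by apply/closed_rootP; rewrite size_char_poly.
rewrite -eigenvalue_root_char => /eigenvalueP[v ve v0].
exists t, (q1^-1%VF v); split; first by rewrite -ker1 memv_ker q1K.
rewrite -ker2 memv_ker linearB linearZ /= -aE -bE.
by rewrite -[v *m b](mulmxKV ua) -(mulmxA v) ve scalemxAl subrr.
Qed.

(** * Growth and maximal quotients of a graded module *)

(** [S] is a graded module over the symmetric algebra of [W], generated in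
    degree 0 and with finite-dimensional pieces. *)

Section GradedModule.
Variables (K : fieldType) (W : vectType K) (S : nat -> vectType K).
Variable mul : forall d, W -> 'Hom(S d, S d.+1).
Hypothesis mul_linear : forall d a l y x,
  mul d (a *: l + y) x = a *: mul d l x + mul d y x.
Hypothesis mulC : forall d l y x, mul d.+1 l (mul d y x) = mul d.+1 y (mul d l x).
Hypothesis gen : forall d (U : {vspace S d.+1}),
  (forall l x, mul d l x \in U) -> U = fullv.

Implicit Types (J : forall d, {vspace S d}) (l y : W) (ls : seq W).

Definition submodule J := forall d l x, x \in J d -> mul d l x \in J d.+1.

(** The sum of [J] and [l S]; since [l] raises degrees, nothing is added in
    degree 0. *)
Definition adjoin J l : forall d, {vspace S d} := fun d =>
  match d with
  | 0 => J 0
  | d'.+1 => (J d'.+1 + limg (mul d' l))%VS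
  end.

(** The quotient [S/J] is nonzero in every degree: the algebraic substitute for
    having a nonempty zero set in projective space. *)
Definition never_full J := forall d, J d <> fullv.

Definition codim J d := (dim (S d) - \dim (J d))%N.

Lemma adjoin_sub J l d : (J d <= adjoin J l d)%VS.
Proof. by case: d => [|d] //=; exact: addvSl. Qed.

Lemma mul_adjoin J l d x : mul d l x \in adjoin J l d.+1.
Proof. by apply: (subvP (addvSr _ _)); rewrite memv_img ?memvf. Qed.

Lemma adjoin_submodule J l : submodule J -> submodule (adjoin J l).
Proof.
move=> sJ [|d] y x /=; first by move=> xJ; apply: (subvP (addvSl _ _)); exact: sJ.
case/memv_addP=> u uJ [v /memv_imgP[w _ ->] ->]; rewrite linearD /= mulC.
by apply: memv_add; [exact: sJ|rewrite memv_img ?memvf].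
Qed.

Lemma foldl_adjoin_sub J ls d : (J d <= foldl adjoin J ls d)%VS.
Proof.
elim: ls J => [|l ls IH] J //=.
exact: subv_trans (adjoin_sub J l d) (IH _).
Qed.

Lemma foldl_adjoin_submodule J ls : submodule J -> submodule (foldl adjoin J ls).
Proof. by elim: ls J => [|l ls IH] J sJ //=; apply: IH; exact: adjoin_submodule. Qed.

Lemma foldl_adjoin_mem J ls l d x : l \in ls -> mul d l x \in foldl adjoin J ls d.+1.
Proof.
elim: ls J => [|y ls IH] J //=; rewrite inE => /predU1P[->|]; last exact: IH.
exact: (subvP (foldl_adjoin_sub _ _ _)) (mul_adjoin _ _ _).
Qed.

Lemma mul0l d x : mul d 0 x = 0.
Proof. by have := mul_linear (-1) 0 0 x; rewrite scaler0 addr0 scaleN1r addNr. Qed.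

Lemma mulZl d a l x : mul d (a *: l) x = a *: mul d l x.
Proof. by have := mul_linear a l 0 x; rewrite !addr0 mul0l addr0. Qed.

Lemma mulDl d l y x : mul d (l + y) x = mul d l x + mul d y x.
Proof. by have := mul_linear 1 l y x; rewrite !scale1r. Qed.

Lemma mul_sum d (I : Type) (r : seq I) (F : I -> W) x :
  mul d (\sum_(i <- r) F i) x = \sum_(i <- r) mul d (F i) x.
Proof.
by elim: r => [|i r IH]; rewrite ?big_nil ?mul0l // !big_cons mulDl IH.
Qed.

Lemma foldl_adjoin_span J ls l d x :
  l \in <<ls>>%VS -> mul d l x \in foldl adjoin J ls d.+1.
Proof.
rewrite -[ls]/(tval (in_tuple ls)) => /coord_span ->; rewrite mul_sum.
apply: memv_suml => i _; rewrite mulZl; apply/memvZ/foldl_adjoin_mem.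
exact: mem_nth.
Qed.

(** Generation in degree 0 lets a vanishing piece of [S/J] kill all later
    ones. *)
Lemma full_upward J d e : submodule J -> J d = fullv -> (d <= e)%N -> J e = fullv.
Proof.
move=> sJ Jd; elim: e => [|e IH]; first by rewrite leqn0 => /eqP <-.
rewrite leq_eqVlt => /predU1P[<- //|]; rewrite ltnS => /IH Je.
by apply: gen => l x; apply: sJ; rewrite Je memvf.
Qed.

Lemma codim_full J d : J d = fullv -> codim J d = 0.
Proof. by rewrite /codim => ->; rewrite dimvf subnn. Qed.

Lemma dim_graded_le J d : (\dim (J d) <= dim (S d))%N.
Proof. by rewrite -dimvf; exact: dimvS (subvf _). Qed.

(** Modulo [J], the image of [l] is already the image of a complement of any
    subspace that [l] sends into [J]. *)
Lemma dim_adjoin_le J l d (U C : {vspace S d}) : submodule J ->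
  (forall x, x \in U -> mul d l x \in J d.+1) -> (U + C)%VS = fullv ->
  (\dim (adjoin J l d.+1) <= \dim (J d.+1) + \dim C)%N.
Proof.
move=> sJ lU UC /=.
have -> : limg (mul d l) = (mul d l @: U + mul d l @: C)%VS by rewrite -UC limgD.
have sU : (mul d l @: U <= J d.+1)%VS.
  by apply/subvP => _ /memv_imgP[x xU ->]; exact: lU.
rewrite addvA (addv_idPl sU); apply: leq_trans (dimv_add_leqif _ _) _.
by rewrite leq_add2l -[leqRHS](limg_ker_dim (mul d l)) leq_addl.
Qed.

(** Exactness of [(S/J)_d -> (S/J)_(d+1) -> (S/(J + l S))_(d+1) -> 0]. *)
Lemma codim_le_adjoin J l d : submodule J ->
  (codim J d.+1 <= codim J d + codim (adjoin J l) d.+1)%N.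
Proof.
move=> sJ; have := dim_adjoin_le (l := l) (U := J d) (C := (J d)^C%VS) sJ.
rewrite addv_complf dimv_compl /codim => /(_ (sJ d l) erefl).
rewrite dimvf; have := dim_graded_le J d; have := dim_graded_le J d.+1.
have := dim_graded_le (adjoin J l) d.+1; rewrite /codim.
move: (\dim (J d)) (\dim (J d.+1)) (\dim (adjoin J l d.+1)) (dim (S d)) (dim (S d.+1)).
by lia.
Qed.

Lemma codim_sum J l d : submodule J ->
  (codim J d <= \sum_(e < d.+1) codim (adjoin J l) e)%N.
Proof.
move=> sJ; elim: d => [|d IH]; first by rewrite big_ord1.
rewrite big_ord_recr /= (leq_trans (@codim_le_adjoin J l d sJ)) //.
by rewrite leq_add2r.
Qed.

(** Each linear form accounts for one summation of the Hilbert function.  The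
    last quotient vanishes in large degrees, so one summation gives a bounded
    function and each of the remaining [size ls] raises the degree of the bound
    by one. *)
Lemma codim_growth J ls l d0 : submodule J ->
  foldl adjoin J (l :: ls) d0 = fullv ->
  exists C, forall d, (codim J d <= C * d.+1 ^ size ls)%N.
Proof.
elim: ls J l => [|y ls IH] J l sJ /= Jd0.
  (* Only degrees below [d0] contribute to the sum in [codim_sum]. *)
  exists (\sum_(e < d0) codim (adjoin J l) e)%N => d.
  rewrite muln1 (leq_trans (@codim_sum J l d sJ)) //.
  have full0 e : (d0 <= e)%N -> codim (adjoin J l) e = 0.
    move=> le0; apply: codim_full.
    exact: full_upward (@adjoin_submodule J l sJ) Jd0 le0.
  have [ltdd0|led0d] := ltnP d d0.
    rewrite [leqRHS](bigID (fun e : 'I_d0 => (e < d.+1)%N)) /=.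
    by rewrite (big_ord_widen_cond d0 xpredT) // leq_addr.
  rewrite (bigID (fun e : 'I_d.+1 => (e < d0)%N)) /= [X in (_ + X)%N]big1 ?addn0.
    by rewrite (big_ord_widen d.+1 (codim (adjoin J l))) // leqW.
  by move=> e; rewrite -leqNgt => /full0.
(* The bound for the module after adding [l], summed over degrees up to [d]. *)
have [C hC] := IH _ _ (@adjoin_submodule J l sJ) Jd0.
exists C => d; apply: leq_trans (@codim_sum J l d sJ) _.
apply: (@leq_trans (\sum_(e < d.+1) C * d.+1 ^ size ls)%N).
  apply: leq_sum => e _; apply: leq_trans (hC e) _.
  rewrite leq_mul2l; apply/orP; right.
  by case: ls {IH Jd0 hC} => // z ls; rewrite leq_exp2r // ltn_ord.
by rewrite sum_nat_const card_ord expnS mulnCA.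
Qed.

Lemma eventually_full J : submodule J -> ~ never_full J ->
  exists d0, forall d, (d0 <= d)%N -> J d = fullv.
Proof.
by move=> sJ /existsNP[d0 /contrapT Jd0]; exists d0 => d; exact: full_upward Jd0.
Qed.

(** The span of the added forms lives in the finite-dimensional space [W], so
    it cannot be enlarged for ever. *)
Lemma maximal_never_full J ls : never_full (foldl adjoin J ls) ->
  exists2 ls', {subset ls <= ls'} & never_full (foldl adjoin J ls') /\
    forall l, l \notin <<ls'>>%VS -> ~ never_full (adjoin (foldl adjoin J ls') l).
Proof.
have [m] := ubnP (dim W - \dim <<ls>>%VS); elim: m ls => // m IH ls le_m pJ.
have [[l [lN pl]]|max] := pselect (exists l, l \notin <<ls>>%VS /\
    never_full (adjoin (foldl adjoin J ls) l)); last first.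
  by exists ls => //; split=> // l lN pl; apply: max; exists l.
have [||ls' sub P] := IH (rcons ls l); rewrite ?foldl_rcons //; last first.
  by exists ls' => // y yls; apply: sub; rewrite mem_rcons inE yls orbT.
rewrite -cats1 span_cat span_seq1.
move: le_m; have := dimvS (subvf (<<ls>> + <[l]>)%VS).
have : (\dim <<ls>> < \dim (<<ls>> + <[l]>))%N.
  rewrite (ltn_leqif (dimv_leqif_sup (addvSl _ _))).
  by apply: contra lN => /subvP; apply; rewrite (subvP (addvSr _ _)) ?memv_line.
by rewrite dimvf; move: (\dim _) (\dim _) (dim W); lia.
Qed.

(** A surjection onto a space of at least the same dimension is injective, here
    for the action of [l] on [S/J].  If [l] also killed [x] modulo [J], it
    would factor through a quotient of smaller dimension. *)
Lemma adjoin_full_inj J l d x : submodule J -> adjoin J l d.+1 = fullv ->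
  (codim J d <= codim J d.+1)%N -> mul d l x \in J d.+1 -> x \in J d.
Proof.
move=> sJ Jl le_codim lx; apply: contraPT lx => xN lx.
have xJ0 : (J d :&: <[x]> = 0)%VS.
  apply/eqP; rewrite -subv0; apply/subvP => y /memv_capP[yJ /vlineP[a ya]].
  rewrite memv0 ya scaler_eq0 -implyNb; apply/implyP => a0; case/negP: xN.
  by rewrite -[x](scalerK a0) -ya memvZ.
pose U := (J d + <[x]>)%VS.
have dimU : \dim U = (\dim (J d)).+1.
  rewrite /U dimv_disjoint_sum // dim_vline.
  have -> : x != 0 by apply: contraNneq xN => ->; rewrite mem0v.
  by rewrite addn1.
have lU (w : S d) : w \in U -> mul d l w \in J d.+1.
  case/memv_addP => u uJ [v /vlineP[a ->] ->]; rewrite linearD linearZ /=.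
  by apply: memvD; [exact: sJ|exact: memvZ].
have := dim_adjoin_le sJ lU (addv_complf U); rewrite Jl dimv_compl !dimvf dimU.
have := dimvS (subvf U); rewrite dimU dimvf.
have := dim_graded_le J d.+1; move: le_codim; rewrite /codim.
move: (\dim (J d)) (\dim (J d.+1)) (dim (S d)) (dim (S d.+1)) => *; lia.
Qed.

End GradedModule.

(** * The maximal space of forms is a hyperplane *)

Section HyperplaneOfMaximalSpan.
Variables (K : closedFieldType) (W : vectType K) (S : nat -> vectType K).
Variable mul : forall d, W -> 'Hom(S d, S d.+1).
Hypothesis mul_linear : forall d a l y x,
  mul d (a *: l + y) x = a *: mul d l x + mul d y x.
Hypothesis mulC : forall d l y x, mul d.+1 l (mul d y x) = mul d.+1 y (mul d l x).
Hypothesis gen : forall d (U : {vspace S d.+1}),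
  (forall l x, mul d l x \in U) -> U = fullv.

(** Every [l] outside [H] acts surjectively on [S/J] in large degrees, so the
    dimensions of the pieces stop decreasing at a positive value and [l] acts
    bijectively from then on.  For fixed [l0] and arbitrary [y], some
    [y - a l0] fails to be injective on one piece; multiplying by powers of
    [l0] carries this failure to all later degrees, so [y - a l0] lies in
    [H]. *)
Lemma maximal_hyperplane (J : forall d, {vspace S d}) (H : {vspace W}) :
    submodule mul J -> never_full J ->
    (forall l d x, l \in H -> mul d l x \in J d.+1) ->
    (forall l, l \notin H -> ~ never_full (adjoin mul J l)) ->
  exists2 l0, l0 \notin H & forall y, exists a, y - a *: l0 \in H.
Proof.
move=> sJ pJ HJ maxH.
have full l : l \notin H -> exists d0, forall d, (d0 <= d)%N -> adjoin mul J l d = fullv.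
  by move=> lN; apply: (eventually_full gen) (maxH l lN); exact: adjoin_submodule.
have [l0 l0N] : exists l0, l0 \notin H.
  apply: contrapT => noN; apply: (pJ 1%N); apply: gen => l x; apply: HJ.
  by apply: contrapT => /negP lN; apply: noN; exists l.
have [d0 hd0] := full l0 l0N.
have codim_le l d : adjoin mul J l d.+1 = fullv -> (codim J d.+1 <= codim J d)%N.
  by move=> e; have := @codim_le_adjoin _ _ _ mul J l d sJ; rewrite (codim_full e) addn0.
(* From the degree [d1] of the smallest piece on, the dimensions are constant. *)
have [d1 [le01 min1]] : exists d1, (d0 <= d1)%N /\
    forall d, (d1 <= d)%N -> (codim J d1 <= codim J d)%N.
  have : exists m, `[< exists2 d, (d0 <= d)%N & codim J d = m >].
    by exists (codim J d0); apply/asboolP; exists d0.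
  case/find_ex_minn => m /asboolP[d1 le1 e1] minm; exists d1; split=> // d le1d.
  by rewrite e1; apply: minm; apply/asboolP; exists d => //; exact: leq_trans le1d.
have codim_cst d : (d1 <= d)%N -> codim J d = codim J d1.
  elim: d => [|d IH]; first by rewrite leqn0 => /eqP ->.
  rewrite leq_eqVlt => /predU1P[<- //|]; rewrite ltnS => le1.
  apply/eqP; rewrite eqn_leq min1 ?(leqW le1) // -(IH le1) andbT.
  by apply: (codim_le l0); apply: hd0; lia.
have inj l d x : l \notin H -> (d1 <= d)%N -> adjoin mul J l d.+1 = fullv ->
    mul d l x \in J d.+1 -> x \in J d.
  move=> lN le1 e; apply: adjoin_full_inj => //.
  by rewrite codim_cst // codim_cst // leqW.
exists l0 => // y.
have [|x /(inj _ _ _ l0N (leqnn d1))|a [u [uN yu]]] := @pencil_degenerate _ _ _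
    (J d1) (J d1.+1) (mul d1 l0) (mul d1 y) (pJ d1).
- by rewrite -/(codim J d1) -(codim_cst d1.+1).
- by apply; apply: hd0; rewrite leqW.
have {}yu : mul d1 (y - a *: l0) u \in J d1.+1.
  by rewrite addrC -scaleNr mul_linear scaleNr addrC.
exists a; apply: contrapT => /negP lN.
set l := y - a *: l0 in yu lN.
(* The degree from which [l] is surjective may exceed [d1], hence the need to
   push the kernel upwards. *)
have ann d : (d1 <= d)%N -> exists2 v, v \notin J d & mul d l v \in J d.+1.
  elim: d => [|d IH]; first by rewrite leqn0 => /eqP e; rewrite -e; exists u.
  rewrite leq_eqVlt => /predU1P[<-|]; first by exists u.
  rewrite ltnS => le1; have [v vN lv] := IH le1.
  exists (mul d l0 v); last by rewrite mulC; exact: sJ.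
  by apply: contra vN => /(inj _ _ _ l0N le1); apply; apply: hd0; lia.
have [d2 hd2] := full l lN.
have [v /negP vN lv] := ann (maxn d1 d2) (leq_maxl _ _).
by apply: vN; apply: inj lv => //; [exact: leq_maxl|apply: hd2; rewrite leqW ?leq_maxr].
Qed.
End HyperplaneOfMaximalSpan.

(** * Polynomials vanishing at every point *)

Section MuniEval.
Variables (n : nat) (R : comNzRingType).
Implicit Type p : {mpoly R[n.+1]}.
Let widen : 'I_n -> 'I_n.+1 := widen_ord (leqnSn n).

Lemma meval_muni p (v : 'I_n.+1 -> R) :
  p.@[v] = (map_poly (meval (v \o widen)) (muni p)).[v ord_max].
Proof.
rewrite {1}[p]mpolyE muniE !raddf_sum /= horner_sum; apply: eq_bigr => m _.
rewrite mevalZ mevalX big_ord_recr /= map_polyZ /= map_polyXn.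
rewrite hornerZ hornerXn mevalZ mevalX mulrA; congr (_ * _ * _).
by apply: eq_bigr => i _; rewrite mnmE.
Qed.

Lemma coef_muni p (m : 'X_{1..n.+1}) :
  ((muni p)`_(m ord_max))@_[multinom m (widen i) | i < n] = p@_m.
Proof.
rewrite muniE coef_sum raddf_sum /= [in RHS](mpolyE p) raddf_sum /=.
apply: eq_bigr => m' _; rewrite coefZ coefXn mcoeffZ mcoeffX.
have [<-|ne_m] := eqVneq m' m; first by rewrite eqxx mulr1 mcoeffZ mcoeffX eqxx.
have [e_last|_] := eqVneq (m ord_max); last by rewrite mulr0 mcoeff0 mulr0.
rewrite mulr1 mcoeffZ mcoeffX; case: eqP => // e_widen; case/eqP: ne_m.
apply/mnmP => i; have [j ->|->] := unliftP ord_max i; last by [].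
have -> : lift ord_max j = widen j.
  by apply: val_inj; rewrite /= /bump leqNgt ltn_ord.
by move/mnmP/(_ j): e_widen; rewrite !mnmE.
Qed.

Lemma muni_eq0 p : muni p = 0 -> p = 0.
Proof. by move=> p0; apply/mpolyP => m; rewrite -coef_muni p0 coef0 !mcoeff0. Qed.
End MuniEval.

(** Induction on the number of variables: [muni] singles out the last one, and
    for fixed values of the others a univariate polynomial with infinitely many
    roots is zero. *)
Lemma mpoly_eq0_eval (K : closedFieldType) n (p : {mpoly K[n]}) :
  (forall v, p.@[v] = 0) -> p = 0.
Proof.
elim: n p => [|n IH] p p0.
  have := p0 (fun _ => 0); rewrite mevalE => p00.
  apply/mpolyP => m; rewrite mcoeff0.
  have m0 (m' : 'X_{1..0}) : m' = m by apply/mnmP => [[]].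
  have [mp|/memN_msupp_eq0 //] := boolP (m \in msupp p).
  rewrite -[RHS]p00 (bigD1_seq m) ?msupp_uniq //= big_ord0 mulr1.
  by rewrite big1 ?addr0 // => m'; rewrite (m0 m') eqxx.
apply: muni_eq0; apply/polyP => k; rewrite coef0; apply: IH => v.
have q0 : map_poly (meval v) (muni p) = 0.
  apply: contrapT => /eqP /closed_nonrootP[t /negP]; apply; apply/rootP.
  pose w (i : 'I_n.+1) := oapp v t (unlift ord_max i).
  have := p0 w; rewrite meval_muni /w unlift_none /= => <-; congr (_.[_]).
  apply: eq_map_poly => q; apply: meval_eq => i /=.
  have -> : widen_ord (leqnSn n) i = lift ord_max i.
    by apply: val_inj; rewrite /= /bump leqNgt ltn_ord.
  by rewrite liftK.
by have := congr1 (fun q : {poly K} => q`_k) q0; rewrite coef_map coef0.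
Qed.

(** * Homogeneous polynomials as a graded module *)

(** A largest subspace contained in [P] is all of [P]; the ideal of a set of
    points, which is given by infinitely many equations, becomes a family of
    subspaces in this way. *)
Lemma vspace_of_pred (K : fieldType) (V : vectType K) (P : V -> Prop) :
  P 0 -> (forall a x y, P x -> P y -> P (a *: x + y)) ->
  exists U : {vspace V}, forall x, x \in U <-> P x.
Proof.
move=> P0 PD.
have [U] : exists U : {vspace V}, forall x, x \in U -> P x.
  by exists 0%VS => x; rewrite memv0 => /eqP ->.
have [k] := ubnP (dim V - \dim U).
elim: k U => // k IH U; rewrite ltnS => le_k UP.
have [[x [Px xU]]|max] := pselect (exists x, P x /\ x \notin U); last first.
  exists U => x; split=> [/UP //|Px]; apply: contrapT => /negP xU.
  by apply: max; exists x.
apply: (IH (U + <[x]>)%VS); last first.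
  move=> _ /memv_addP[u /UP Pu [_ /vlineP[a ->] ->]].
  by rewrite addrC; exact: PD.
have: (\dim U < \dim (U + <[x]>))%N.
  rewrite (ltn_leqif (dimv_leqif_sup (addvSl _ _))).
  by apply: contra xU => /subvP; apply; rewrite (subvP (addvSr _ _)) ?memv_line.
have := dimvS (subvf (U + <[x]>)%VS); rewrite dimvf.
by move: (\dim _) (\dim _) (dim V) le_k => *; lia.
Qed.

Section PolynomialModule.
Variables (K : closedFieldType) (n : nat).
Local Notation S := (dhomog n.+1 K).
Implicit Types (l y c : 'rV[K]_n.+1).

Definition linear_form l : {mpoly K[n.+1]} := \sum_i l 0 i *: 'X_i.

Lemma linear_form_is_linear : linear linear_form.
Proof.
move=> a l y; rewrite /linear_form scaler_sumr -big_split /=.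
by apply: eq_bigr => i _; rewrite !mxE scalerDl scalerA.
Qed.

HB.instance Definition _ := GRing.isLinear.Build K 'rV[K]_n.+1 {mpoly K[n.+1]} _
  linear_form linear_form_is_linear.

Lemma linear_form_delta i : linear_form (delta_mx 0 i) = 'X_i.
Proof.
rewrite /linear_form (bigD1 i) //= mxE !eqxx scale1r big1 ?addr0 // => j ne.
by rewrite mxE (negPf ne) andbF scale0r.
Qed.

Lemma linear_form_homog l : linear_form l \is 1.-homog.
Proof.
by apply: rpred_sum => i _; apply: rpredZ; rewrite dhomogX /= mdeg1.
Qed.

Lemma form_mul_homog d l (f : S d) : linear_form l * val f \is d.+1.-homog.
Proof. exact: dhomogM (linear_form_homog l) (valP f). Qed.

Definition form_mul_fun d l (f : S d) : S d.+1 := DHomog (form_mul_homog l f).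

Lemma form_mul_is_linear d l : linear (@form_mul_fun d l).
Proof.
by move=> a f g; apply: val_inj; rewrite /= mulrDr scalerAr.
Qed.

HB.instance Definition _ d l := GRing.isLinear.Build K (S d) (S d.+1) _
  (@form_mul_fun d l) (@form_mul_is_linear d l).

Definition form_mul d l : 'Hom(S d, S d.+1) := linfun (@form_mul_fun d l).

Lemma form_mulE d l f : val (form_mul d l f) = linear_form l * val f.
Proof. by rewrite lfunE. Qed.

Lemma form_mul_linear d a l y f :
  form_mul d (a *: l + y) f = a *: form_mul d l f + form_mul d y f.
Proof.
apply: val_inj; rewrite form_mulE linearP /= !form_mulE.
by rewrite mulrDl scalerAl.
Qed.

Lemma form_mulC d l y f :
  form_mul d.+1 l (form_mul d y f) = form_mul d.+1 y (form_mul d l f).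
Proof. by apply: val_inj; rewrite !form_mulE mulrCA. Qed.

(** A monomial of positive degree is a variable times a monomial. *)
Lemma dhomog_ind d (P : S d.+1 -> Prop) :
    P 0 -> (forall a f g, P f -> P g -> P (a *: f + g)) ->
    (forall i g, P (form_mul d (delta_mx 0 i) g)) ->
  forall f, P f.
Proof.
move=> P0 PD PX f; have degf := dhomog_mf (valP f).
have fE : f = \sum_(m <- msupp (val f)) (val f)@_m *: indhomog d.+1 'X_[m].
  apply: val_inj; rewrite [LHS]mpolyE raddf_sum big_seq [RHS]big_seq.
  apply: eq_bigr => m mf; rewrite -[RHS]/(_ *: val (indhomog _ _)) insubdK //.
  by rewrite unfold_in dhomogX; apply/eqP/degf.
rewrite fE big_seq; elim/big_ind: _ => // [g h Pg Ph|m mf].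
  by rewrite -[g]scale1r; exact: PD.
have /eqP : mdeg m = d.+1 by exact: degf.
rewrite -[_ *: _]addr0 => degm; apply: (PD) => //.
have [i mi] : exists i, (0 < m i)%N.
  apply: contrapT => m0; move: degm; rewrite mdegE big1 // => i _.
  by apply/eqP; rewrite -leqn0 leqNgt; apply/negP => ?; apply: m0; exists i.
have mE : m = (U_(i) + (m - U_(i)))%MM.
  apply/mnmP => j; rewrite !mnmE; case: eqP => [<-|_] /=; last by rewrite subn0.
  by rewrite subnKC.
have degm' : mdeg (m - U_(i))%MM == d.
  by move: degm; rewrite {1}mE mdegD mdeg1.
have -> : indhomog d.+1 'X_[m] =
    form_mul d (delta_mx 0 i) (indhomog d 'X_[(m - U_(i))%MM]).
  apply: val_inj; rewrite form_mulE linear_form_delta /= !insubdK //.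
  - by rewrite -mpolyXD -mE.
  - by rewrite unfold_in dhomogX.
  - by rewrite unfold_in dhomogX.
exact: PX.
Qed.

Lemma dhomog_gen d (U : {vspace S d.+1}) :
  (forall l f, form_mul d l f \in U) -> U = fullv.
Proof.
move=> UX; apply/vspaceP => f; rewrite memvf; move: f.
apply: dhomog_ind => [|a f g fU gU|i g]; first by rewrite mem0v.
- by rewrite memvD // memvZ.
- by rewrite UX.
Qed.

(** Projective Nullstellensatz.  Enlarge [ls] to a maximal sequence, with span
    [H] and quotient [S/J'].  The hyperplane [H] consists of the forms vanishing
    at the point [c], where ['X_i] is congruent to [c_i l0] modulo [H].  Hence
    every homogeneous [f] of degree [d] is congruent to [f(c) l0^d] modulo [J'].
    An [f] in [J] with [f(c) != 0] would put [l0^d], and with it everything of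
    degree [d], into [J']. *)
Lemma never_full_common_zero (J : forall d, {vspace S d}) (ls : seq 'rV[K]_n.+1) :
    submodule form_mul J -> never_full (foldl (adjoin form_mul) J ls) ->
  exists c, [/\ c != 0, forall l, l \in ls -> l *m c^T = 0
    & forall d f, f \in J d -> (val f).@[fun i => c 0 i] = 0].
Proof.
move=> sJ /maximal_never_full[ls' sub_ls [pJ maxJ]].
have sJ' : submodule form_mul (foldl (adjoin form_mul) J ls').
  by apply: foldl_adjoin_submodule => //; exact: form_mulC.
have mem_span l d x : l \in <<ls'>>%VS ->
    form_mul d l x \in foldl (adjoin form_mul) J ls' d.+1.
  by apply: foldl_adjoin_span; exact: form_mul_linear.
have [l0 l0N hyp] := maximal_hyperplane form_mul_linear form_mulC
  dhomog_gen sJ' pJ mem_span maxJ.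
set J' := foldl _ J ls' in pJ sJ' mem_span.
have /choice[a aP] i := hyp (delta_mx 0 i).
pose c := \row_i a i.
have cP y : y - (y *m c^T) 0 0 *: l0 \in <<ls'>>%VS.
  rewrite {1}[y]row_sum_delta mxE scaler_suml -sumrB; apply: memv_suml => i _.
  by rewrite !mxE -scalerA -scalerBr memvZ.
(* [l0] is not in [H], so a form in [H] has coefficient [0] along [l0]. *)
have c_eq0 y : y \in <<ls'>>%VS -> (y *m c^T) 0 0 = 0.
  move=> yH; apply: contraNeq l0N => ne0.
  rewrite -[l0](scalerK ne0) memvZ // -[X in X \in _]opprK memvN.
  by rewrite -[- _](addKr y) memvD // memvN.
exists c; split=> [|l /sub_ls lls|d f fJ].
- apply: contraNneq l0N => c0.
  by have := cP l0; rewrite c0 trmx0 mulmx0 mxE scale0r subr0.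
- apply/matrixP => i j; rewrite !ord1 c_eq0 ?mxE //.
  exact: memv_span.
have pow_homog e : linear_form l0 ^+ e \is e.-homog.
  by rewrite -[e in e.-homog]mul1n; exact: dhomogMn (linear_form_homog l0).
pose L e : S e := DHomog (pow_homog e).
have mod_pow e (g : S e) : g - (val g).@[fun i => c 0 i] *: L e \in J' e.
  elim: e g => [|e IH].
    move=> g; have gE : val g = ((val g)@_0)%:MP.
      apply/mpolyP => m; rewrite mcoeffC; have [<-|ne] := eqVneq 0%MM m.
        by rewrite mulr1.
      rewrite mulr0; apply: (dhomog_nemf_coeff (valP g)).
      by rewrite /= mdeg_eq0 eq_sym.
    rewrite gE mevalC; set b := _@_0.
    suff -> : g - b *: L 0 = 0 by rewrite mem0v.
    by apply: val_inj; rewrite -[LHS]/(val g - b *: 1) gE alg_mpolyC subrr.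
  apply: dhomog_ind => [|b g h gJ hJ|i g].
  - by rewrite /= meval0 scale0r subr0 mem0v.
  - rewrite -[val (_ + _)]/(b *: val g + val h) mevalD mevalZ scalerDl opprD addrACA.
    by rewrite -scalerA -scalerBr memvD ?memvZ.
  - rewrite form_mulE linear_form_delta mevalM mevalXU.
    have -> : L e.+1 = form_mul e l0 (L e).
      by apply: val_inj; rewrite form_mulE /= exprS.
    set b := (val g).@[_].
    have -> : form_mul e (delta_mx 0 i) g - (c 0 i * b) *: form_mul e l0 (L e)
      = form_mul e (delta_mx 0 i) (g - b *: L e)
        + b *: form_mul e (delta_mx 0 i - c 0 i *: l0) (L e).
      rewrite [delta_mx 0 i - _]addrC -[- (c 0 i *: l0)]scaleNr.
      rewrite form_mul_linear linearB linearZ /=.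
      rewrite scalerDr scalerA mulrN scaleNr [b * _]mulrC [- _ + _]addrC.
      by rewrite addrA linearZ scalerN subrK.
    apply: memvD; first by apply: sJ'; exact: IH.
    by apply/memvZ/mem_span; rewrite /c mxE; exact: aP.
apply: contrapT => /eqP ne0; apply: (pJ d); apply/vspaceP => g; rewrite memvf.
have LJ : L d \in J' d.
  rewrite -[L d](scalerK ne0) memvZ // -[X in X \in _]opprK memvN.
  rewrite -[- _](addKr f) memvD ?mod_pow // memvN.
  exact: subvP (foldl_adjoin_sub _ _ _ _) _ fJ.
by rewrite -[g](subrK ((val g).@[fun i => c 0 i] *: L d)) memvD ?mod_pow ?memvZ.
Qed.
End PolynomialModule.

(** * Linear sections of a cone *)

Lemma expn_leq_ffact d k : (d.+1 ^ k <= (d + k) ^_ k)%N.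
Proof.
elim: k => [|k IH]; first by rewrite ffactn0.
by rewrite addnS ffactSS expnS leq_mul // ltnS leq_addr.
Qed.

Lemma binomial_outgrows C t k : (t < k)%N -> exists d, (C * d.+1 ^ t < 'C(d + k, d))%N.
Proof.
move=> ltk; exists (C * k`!)%N; set d := (C * k`!)%N.
rewrite -(ltn_pmul2r (fact_gt0 k)) -(bin_sub (leq_addr k d)) addKn bin_ffact.
apply: leq_trans (expn_leq_ffact d k).
rewrite mulnAC -/d; apply: (@leq_trans (d.+1 ^ t.+1)).
  by rewrite expnS ltn_pmul2r // expn_gt0.
by rewrite leq_pexp2l.
Qed.

Lemma dhomog_prod_seq (R : comNzRingType) n (I : Type) (s : seq I) (d : I -> nat)
    (F : I -> {mpoly R[n]}) :
  (forall i, F i \is (d i).-homog) ->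
  \prod_(i <- s) F i \is (\sum_(i <- s) d i)%N.-homog.
Proof.
move=> Fd; elim: s => [|i s IH]; first by rewrite !big_nil dhomog1.
by rewrite !big_cons dhomogM.
Qed.

Lemma comp_vars_homog (R : comNzRingType) D N (z : 'I_D -> 'I_N) d (f : {mpoly R[D]}) :
  f \is d.-homog -> f \mPo [tuple 'X_(z i) | i < D] \is d.-homog.
Proof.
move=> /dhomog_mf fd; rewrite comp_mpolyEX big_seq.
apply: rpred_sum => m mf; apply: rpredZ; rewrite comp_mpolyX.
have <- : mdeg m = d by exact: fd.
rewrite mdegE; apply: dhomog_prod_seq => i; rewrite tnth_mktuple.
by rewrite -[X in X.-homog]mul1n; apply: dhomogMn; rewrite dhomogX /= mdeg1.
Qed.

(** Linear equations are given by row vectors [l].  If adding the forms [ls]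
    made the quotient of the polynomial ring by the ideal of [X] vanish in some
    degree, its Hilbert function would be bounded by a polynomial of degree
    [size ls - 1 < D - 1].  But polynomials in the [D] coordinates [z] inject
    into that quotient. *)
Lemma linear_section_of_cone (K : closedFieldType) N (X : 'rV[K]_N -> Prop) D (z : 'I_D -> 'I_N)
    (ls : seq 'rV[K]_N) :
    (size ls < D)%N ->
    (forall f : {mpoly K[D]},
      (forall c, X c -> f.@[fun i => c 0 (z i)] = 0) -> f = 0) ->
  exists c : 'rV[K]_N, [/\ c != 0, forall l, l \in ls -> l *m c^T = 0
    & forall d (f : {mpoly K[N]}), f \is d.-homog ->
      (forall x, X x -> f.@[fun i => x 0 i] = 0) -> f.@[fun i => c 0 i] = 0].
Proof.
case: D z => // k z; rewrite ltnS => ltk indep.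
case: N X z ls ltk indep => [|n] X z ls ltk indep; first by case: (z ord0).
have exJ d : exists U : {vspace dhomog n.+1 K d},
    forall f, f \in U <-> forall x, X x -> (val f).@[fun i => x 0 i] = 0.
  apply: vspace_of_pred => [x _|a f g f0 g0 x Xx]; first by rewrite meval0.
  rewrite -[val _]/(a *: val f + val g) mevalD mevalZ f0 // g0 //.
  by rewrite mulr0 addr0.
pose J d := projT1 (cid (exJ d)).
have JP d : forall f, f \in J d <-> _ := projT2 (cid (exJ d)).
have sJ : submodule (@form_mul K n) J.
  move=> d l f /JP f0; apply/JP => x Xx.
  by rewrite form_mulE mevalM f0 ?mulr0.
(* Rename the variables along [z]; by independence the image of the renaming
   meets [J] trivially. *)
have codimJ d : ('C(d + k, d) <= codim J d)%N.
  pose r (f : dhomog k.+1 K d) : dhomog n.+1 K d :=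
    DHomog (comp_vars_homog z (valP f)).
  have rlin : linear r.
    by move=> a f g; apply: val_inj; rewrite /= linearP.
  pose rL := linfun (HB.pack_for {linear dhomog k.+1 K d -> dhomog n.+1 K d} r
    (GRing.isLinear.Build K (dhomog k.+1 K d) (dhomog n.+1 K d) *:%R r rlin)).
  have rJ f : rL f \in J d -> f = 0.
    rewrite lfunE /= => /JP rf; apply: val_inj; apply: indep => x Xx.
    have := rf x Xx; rewrite /= comp_mpoly_meval => <-.
    by apply: meval_eq => i; rewrite tnth_mktuple mevalXU.
  have ker0 : (fullv :&: lker rL = 0)%VS.
    apply/eqP; rewrite -subv0; apply/subvP => f /memv_capP[_].
    by rewrite memv_ker memv0 => /eqP rf; apply/eqP/rJ; rewrite rf mem0v.
  have cap0 : (limg rL :&: J d = 0)%VS.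
    apply/eqP; rewrite -subv0; apply/subvP => _ /memv_capP[/memv_imgP[f _ ->]].
    by move=> /rJ ->; rewrite linear0 mem0v.
  have := dimvS (subvf (limg rL + J d)%VS).
  rewrite dimv_disjoint_sum // (limg_dim_eq ker0) !dimvf.
  rewrite /codim; move: (\dim (J d)) => u le_u.
  by rewrite leq_subRL ?(leq_trans _ le_u) ?leq_addl // addnC.
have [pJ|] := pselect (never_full (foldl (adjoin (@form_mul K n)) J ls)).
  have [c [c0 lc fc]] := never_full_common_zero sJ pJ.
  exists c; split=> // d f fd fX.
  by apply: (fc d (DHomog fd)); apply/JP.
move=> /existsNP[d0 /contrapT Jd0]; exfalso.
(* Without any equation the quotient itself would vanish in degree [d0]. *)
case: ls ltk Jd0 => [|l ls] ltk Jd0.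
  have := codimJ d0; rewrite (codim_full Jd0) leqn0 => /eqP C0.
  by have := bin_gt0 (d0 + k) d0; rewrite C0 leq_addr.
have [C hC] := codim_growth (@form_mulC K n) (@dhomog_gen K n) sJ Jd0.
have [d] := binomial_outgrows C ltk.
by rewrite ltnNge (leq_trans (codimJ d) (hC d)).
Qed.

(** * Matrices of low rank in linear families *)

Lemma dhomog_det (R : comNzRingType) n r (A : 'M[{mpoly R[n]}]_r) :
  (forall i j, A i j \is 1.-homog) -> \det A \is r.-homog.
Proof.
move=> A1; apply: rpred_sum => s _; rewrite rpredMsign.
have := dhomog_prod_seq (index_enum 'I_r) (fun i => A1 i (s i)).
by rewrite sum1_card card_ord.
Qed.

Lemma rank_minor (K : fieldType) a b (M : 'M[K]_(a, b)) :
  exists (f : 'I_(\rank M) -> 'I_a) (g : 'I_(\rank M) -> 'I_b),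
    \det (mxsub f g M) != 0.
Proof.
pose f := maxrankfun M; pose M1 := rowsub f M.
have full1 : row_full M1^T.
  by rewrite /row_full mxrank_tr; have := maxrowsub_free M.
exists f, (fullrankfun full1); have := fullrowsub_full full1.
rewrite row_full_unit unitmxE unitfE -det_tr trmx_mxsub trmxK.
by rewrite /M1 -mxsub_comp.
Qed.

Lemma det_mxsub_eq0 (K : fieldType) a b r (f : 'I_r -> 'I_a) (g : 'I_r -> 'I_b)
    (M : 'M[K]_(a, b)) :
  (\rank M < r)%N -> \det (mxsub f g M) = 0.
Proof.
move=> ltr; apply/eqP; apply: contraTT ltr; rewrite -unitfE -unitmxE -leqNgt.
rewrite -row_free_unit => /eqP {1}<-; rewrite mxsubrc.
apply: leq_trans (mxrankS (rowsub_sub _ _)) _.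
rewrite -[\rank (colsub _ _)]mxrank_tr trmx_mxsub -[leqRHS]mxrank_tr.
by rewrite mxrankS // rowsub_sub.
Qed.

Section Determinantal.
Variables (K : closedFieldType) (a b r : nat).
Hypotheses (r_gt0 : (0 < r)%N) (le_ra : (r <= a)%N) (le_rb : (r <= b)%N).

(** The positions in the first [r] rows or the first [r] columns.  These entries
    of a matrix of rank at most [r] can be prescribed freely as long as the
    upper left [r] by [r] corner is invertible. *)
Definition hook : {set 'I_a * 'I_b} :=
  [set p : 'I_a * 'I_b | (p.1 < r)%N || (p.2 < r)%N].

Lemma card_hook : (a * b <= #|hook| + (a - r) * (b - r))%N.
Proof.
have card_ge n : (#|[pred i : 'I_n | (r <= i)%N]| <= n - r)%N.
  rewrite -sum1_card.
  by rewrite -(big_geq_mkord r n predT (fun=> 1%N)) sum_nat_const_nat muln1.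
have cardT : #|{: 'I_a * 'I_b}| = (a * b)%N by rewrite card_prod !card_ord.
rewrite -cardT -(cardsC hook) leq_add2l.
apply: leq_trans (leq_mul (card_ge a) (card_ge b)).
rewrite -cardX; apply: subset_leq_card; apply/subsetP => [[i j]].
by rewrite !inE /= negb_or -!leqNgt.
Qed.

Definition hook_var (k : 'I_#|hook|) : 'I_(a * b) :=
  mxvec_index (enum_val k).1 (enum_val k).2.

(** Given entries [w] on the hook with invertible corner [B], the matrix
    [L B^-1 T], where [L] consists of the first columns and [T] of the first
    rows, has rank at most [r] and restricts to [w].  So [f] vanishes at [w]
    whenever [det B] does not, hence the product of [f] and the determinant of
    the corner vanishes everywhere. *)
Lemma hook_independent (f : {mpoly K[#|hook|]}) :
  (forall c : 'rV_(a * b), (\rank (vec_mx c : 'M_(a, b)) <= r)%N ->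
    f.@[fun k => c 0 (hook_var k)] = 0) -> f = 0.
Proof.
move=> f0.
pose wa := widen_ord le_ra; pose wb := widen_ord le_rb.
have z0 : (wa (Ordinal r_gt0), wb (Ordinal r_gt0)) \in hook by rewrite inE /= r_gt0.
pose idx i j := enum_rank_in z0 (i, j).
pose g : {mpoly K[#|hook|]} := \det (\matrix_(i < r, j < r) 'X_(idx (wa i) (wb j))).
have gE w : g.@[w] = \det (\matrix_(i < r, j < r) w (idx (wa i) (wb j))).
  rewrite -det_map_mx; congr (\det _); apply/matrixP => i j.
  by rewrite !mxE /= mevalXU.
(* The determinant of the corner is not the zero polynomial: evaluate it at the
   identity matrix. *)
have g_neq0 : g != 0.
  apply/eqP => g0; have := gE (fun k => ((enum_val k).1 == (enum_val k).2 :> nat)%:R).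
  rewrite g0 meval0; apply/eqP; rewrite eq_sym.
  rewrite (_ : \matrix_(i, j) _ = 1%:M) ?det1 ?oner_eq0 //.
  apply/matrixP => i j; rewrite !mxE enum_rankK_in //=.
  by rewrite inE /= ltn_ord.
suff /eqP : f * g = 0 by rewrite mulf_eq0 (negPf g_neq0) orbF => /eqP.
apply: mpoly_eq0_eval => w; rewrite mevalM gE; set d := \det _.
have [->|d0] := eqVneq d 0; first by rewrite mulr0.
(* Off the hook, [idx] takes a default value; only the entries on the hook enter
   [M1]. *)
pose M : 'M_(a, b) := \matrix_(i, j) w (idx i j).
have dE : d = \det (mxsub wa wb M).
  by congr (\det _); apply/matrixP => i j; rewrite !mxE.
have uA : mxsub wa wb M \in unitmx by rewrite unitmxE unitfE -dE.
pose M1 := colsub wb M *m invmx (mxsub wa wb M) *m rowsub wa M.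
have rkM1 : (\rank M1 <= r)%N.
  by apply: leq_trans (mxrankM_maxl _ _) _; exact: rank_leq_col.
have rowM1 : rowsub wa M1 = rowsub wa M.
  by rewrite /M1 -!mul_rowsub_mx -mxsubrc mulmxV // mul1mx.
have colM1 : colsub wb M1 = colsub wb M.
  by rewrite /M1 -mulmx_colsub -mxsubcr mulmxKV.
suff -> : f.@[w] = 0 by rewrite mul0r.
rewrite -(f0 (mxvec M1)) ?mxvecK //; apply: meval_eq => k; rewrite mxvecE.
have Mk : M (enum_val k).1 (enum_val k).2 = w k.
  by rewrite mxE /idx -surjective_pairing enum_valK_in.
rewrite -Mk; have := enum_valP k; rewrite inE; case/orP => lt_r.
  have rowE (B : 'M[K]_(a, b)) : B (enum_val k).1 =1 rowsub wa B (Ordinal lt_r).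
    by move=> j; rewrite mxE; congr (B _ _); exact: val_inj.
  by rewrite !rowE rowM1.
have colE (B : 'M[K]_(a, b)) i : B i (enum_val k).2 = colsub wb B i (Ordinal lt_r).
  by rewrite mxE; congr (B _ _); exact: val_inj.
by rewrite !colE colM1.
Qed.
End Determinantal.

(** The matrices of rank at most [r] form a cone on which the hook coordinates
    are independent, and the image of [F] is cut out by [a b - m] equations when
    [F] is injective, fewer than the size of the hook.  A common zero in the
    image makes all minors of size larger than [r] vanish, since these are
    homogeneous polynomials vanishing on the cone. *)
Lemma low_rank_in_linear_family (K : closedFieldType) m a b r
    (F : {linear 'rV[K]_m -> 'M[K]_(a, b)}) :
  ((a - r) * (b - r) < m)%N -> exists2 v, v != 0 & (\rank (F v) <= r)%N.
Proof.
move=> lt_m; have m_gt0 : (0 < m)%N by apply: leq_ltn_trans lt_m.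
have [le_ar|lt_ra] := leqP a r.
  exists (const_mx 1); last by apply: leq_trans le_ar; exact: rank_leq_row.
  by apply/eqP => /rowP/(_ (Ordinal m_gt0)); rewrite !mxE; apply/eqP/oner_neq0.
have [le_br|lt_rb] := leqP b r.
  exists (const_mx 1); last by apply: leq_trans le_br; exact: rank_leq_col.
  by apply/eqP => /rowP/(_ (Ordinal m_gt0)); rewrite !mxE; apply/eqP/oner_neq0.
pose P : 'M[K]_(m, a * b) := lin1_mx (mxvec \o F).
have PE v : v *m P = mxvec (F v) by rewrite mul_rV_lin1.
have [freeP|] := boolP (row_free P); last first.
  rewrite -kermx_eq0 => /rowV0Pn[v /sub_kermxP vP v0]; exists v => //.
  by rewrite -[F v]mxvecK -PE vP linear0 mxrank0.
(* An injective family cannot have more than [a b] parameters. *)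
have r_gt0 : (0 < r)%N.
  case: r lt_m {lt_ra lt_rb} => //; rewrite !subn0 => lt_m.
  by have := rank_leq_col P; rewrite (eqP freeP) leqNgt lt_m.
pose C := col_base (cokermx P).
pose ls := [seq (col j C)^T | j <- enum 'I_(\rank (cokermx P))].
have size_ls : (size ls < #|hook a b r|)%N.
  rewrite size_map size_enum_ord mxrank_coker (eqP freeP).
  have := card_hook a b r; have := rank_leq_col P; rewrite (eqP freeP).
  by move: lt_m; move: (#|_|) (_ * _)%N (_ * _)%N => *; lia.
have [c [c0 cls cpol]] := linear_section_of_cone size_ls
  (hook_independent r_gt0 (ltnW lt_ra) (ltnW lt_rb)).
have /submxP[v cE] : (c <= P)%MS.
  rewrite submxE -(mulmx_base (cokermx P)) mulmxA.
  suff -> : c *m C = 0 by rewrite mul0mx.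
  apply/rowP => j; have := cls (col j C)^T (map_f _ (mem_enum _ j)).
  move/matrixP/(_ 0 0); rewrite !mxE => e; rewrite -[RHS]e.
  by apply: eq_bigr => k _; rewrite !mxE mulrC.
exists v; first by apply: contraNneq c0 => v0; rewrite cE v0 mul0mx.
have FvE : F v = vec_mx c by rewrite cE PE mxvecK.
rewrite FvE leqNgt; apply/negP => lt_rk.
(* If the rank exceeded [r], a nonvanishing minor of the size of the rank would
   contradict the vanishing of the corresponding polynomial. *)
have [f [g /eqP]] := rank_minor (vec_mx c : 'M_(a, b)).
set k := \rank _ in lt_rk f g *; apply.
pose p := \det (\matrix_(i < k, j < k) 'X_(mxvec_index (f i) (g j))) : {mpoly K[a * b]}.
have pE (x : 'rV_(a * b)) :
    p.@[fun i => x 0 i] = \det (mxsub f g (vec_mx x : 'M_(a, b))).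
  rewrite -det_map_mx; congr (\det _); apply/matrixP => i j.
  by rewrite !mxE /= mevalXU.
rewrite -pE; apply: (cpol k) => [|x rkx].
  by apply: dhomog_det => i j; rewrite mxE dhomogX /= mdeg1.
by rewrite pE det_mxsub_eq0 // (leq_ltn_trans rkx).
Qed.

(** * Quotients of Kronecker modules *)

Section Kronecker.
Variables (K : closedFieldType) (T : finType) (m q : nat) (A : T -> 'M[K]_(m, q)).
Local Notation n := #|T|.

(** The map [u |-> sum_t (e_t (x) A_t u)], on row vectors and with the tensor
    product of [K^n] and [K^m] identified with ['rV_(n * m)] by [mxvec]. *)
Definition flattening : 'M[K]_(q, n * m) :=
  \matrix_(s < q) mxvec (\matrix_(l < n, i < m) A (enum_val l) i s).

Lemma mul_flatteningE k (Y : 'M_(k, q)) s l i :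
  (Y *m flattening) s (mxvec_index l i) = (A (enum_val l) *m Y^T) i s.
Proof.
rewrite [LHS]mxE [RHS]mxE; apply: eq_bigr => j _.
rewrite [flattening _ _]mxE mxvecE [in LHS]mxE [Y^T _ _]mxE; exact: mulrC.
Qed.

(** The map [c |-> c (x) v]. *)
Definition tensor_row (v : 'rV[K]_m) : 'M[K]_(n, n * m) :=
  \matrix_(l0 < n) mxvec (\matrix_(l < n, i < m) ((l0 == l)%:R * v 0 i)).

Lemma tensor_rowE v l0 l i :
  tensor_row v l0 (mxvec_index l i) = (l0 == l)%:R * v 0 i.
Proof. by rewrite [LHS]mxE mxvecE mxE. Qed.

Lemma mul_tensor_rowE k (Z : 'M_(k, n)) v s l i :
  (Z *m tensor_row v) s (mxvec_index l i) = Z s l * v 0 i.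
Proof.
rewrite mxE (bigD1 l) //= tensor_rowE eqxx mul1r.
by rewrite big1 ?addr0 // => j ne; rewrite tensor_rowE (negPf ne) mul0r mulr0.
Qed.

Lemma tensor_row_is_linear : linear tensor_row.
Proof.
move=> a v w; apply/matrixP => l0 k; case/mxvec_indexP: k => l i.
rewrite tensor_rowE [RHS]mxE [in RHS]mxE.
by rewrite !tensor_rowE !mxE mulrDr mulrCA.
Qed.

Lemma tensor_row_free v : v != 0 -> row_free (tensor_row v).
Proof.
move=> v0; apply: row_free0 => u u0; apply/rowP => l; rewrite mxE.
have [i vi] : exists i, v 0 i != 0.
  by apply/existsP; apply: contraNT v0 => /existsPn h; apply/eqP/rowP => i;
    rewrite mxE; apply/eqP; rewrite -[_ == _]negbK.
have := mul_tensor_rowE u v 0 l i; rewrite u0 mxE => /esym/eqP.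
by rewrite mulf_eq0 (negPf vi) orbF => /eqP.
Qed.

(** With [B] for [flattening] and [d] for the dimension of its kernel, the
    cokernel of [B] has dimension [n m - q + d].  The map from [K^n] to it given
    by [c |-> c (x) v] is linear in [v], so for some [v != 0] its rank is at
    most [n - (k - d)]: the numerical hypothesis, which has [q - k] for the
    dimension of the subspace at the target and [m - 1] for that at the source,
    is what the codimension count requires.  Then the image of [B] contains a
    [(k - d)]-dimensional space of tensors [c (x) v]; together with the kernel
    of [B] its preimage has dimension at least [k]. *)
Lemma common_quotient k :
  (k <= n)%N -> (0 < m)%N -> (k <= q)%N ->
  (k * (n * m.-1 - (q - k)) < m)%N ->
  exists (v : 'cV[K]_m) (G : 'M[K]_(q, k)) (c : T -> 'rV[K]_k),
    [/\ v != 0, row_full G & forall t, A t *m G = v *m c t].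
Proof.
move=> le_kn m_gt0 le_kq lt_m; pose B := flattening; pose d := (q - \rank B)%N.
pose C := col_base (cokermx B).
pose F (v : 'rV[K]_m) := tensor_row v *m C.
have F_lin : linear F.
  by move=> a v w; rewrite /F tensor_row_is_linear mulmxDl -scalemxAl.
pose FL := HB.pack_for {linear 'rV[K]_m -> 'M[K]_(n, \rank (cokermx B))} F
  (GRing.isLinear.Build K 'rV[K]_m 'M[K]_(n, \rank (cokermx B)) *:%R F F_lin).
have le_rkB : (\rank B <= q)%N := rank_leq_row B.
have [|v v0 rkv] := @low_rank_in_linear_family K m n (\rank (cokermx B))
  (n - (k - d)) FL.
  rewrite mxrank_coker subKn ?(leq_trans (leq_subr _ _)) //.
  (* If [d >= k], the truncated difference makes the required codimension [0]. *)
  have [le_kd|lt_dk] := leqP k d; first by rewrite (eqP le_kd) mul0n.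
  apply: leq_ltn_trans lt_m; apply: leq_mul; first exact: leq_subr.
  rewrite -{1}(prednK m_gt0) mulnS; move: (n * m.-1)%N => u.
  move: le_kn le_kq le_rkB lt_dk; rewrite /d.
  by move: (\rank B) => rB; move: n => N; lia.
pose E := tensor_row v.
(* The vectors that [B] sends into the tensors [c (x) v]. *)
pose V := kermx (B *m cokermx E).
have rkV : (k <= \rank V)%N.
  pose W := kermx (E *m C) *m E.
  have rkW : (k - d <= \rank W)%N.
    rewrite mxrankMfree ?tensor_row_free // mxrank_ker.
    have := leq_sub2l n rkv; rewrite subKn //.
    by rewrite (leq_trans (leq_subr _ _)).
  have /submxP[Y WE] : (W <= B)%MS.
    rewrite submxE -(mulmx_base (cokermx B)) mulmxA -[W *m _]mulmxA.
    by rewrite mulmx_ker mul0mx.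
  have YV : (Y <= V)%MS.
    by apply/sub_kermxP; rewrite mulmxA -WE -mulmxA mulmx_coker mulmx0.
  have kerV : (kermx B <= V)%MS.
    by apply/sub_kermxP; rewrite mulmxA mulmx_ker mul0mx.
  have := mxrank_mul_ker V B.
  have : (\rank (kermx B) <= \rank (V :&: kermx B))%N.
    by apply: mxrankS; rewrite sub_capmx kerV submx_refl.
  have : (\rank W <= \rank (V *m B))%N by rewrite WE mxrankS // submxMr.
  rewrite mxrank_ker; move: (\rank (V *m B)) (\rank (V :&: kermx B)) => *; lia.
pose Y : 'M[K]_(k, q) := pid_mx k *m row_base V.
have freeY : row_free Y.
  by apply: row_freeM (row_base_free V); rewrite /row_free rank_pid_mx.
have /submxP[Z ZE] : (Y *m B <= E)%MS.
  rewrite submxE -mulmxA; apply/eqP/sub_kermxP.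
  by apply: submx_trans (submxMl _ _) _; rewrite eq_row_base.
exists v^T, Y^T, (fun t => (col (enum_rank t) Z)^T); split=> [||t].
- by rewrite trmx_eq0.
- by rewrite /row_full mxrank_tr.
apply/matrixP => i s.
have := mul_flatteningE Y s (enum_rank t) i.
rewrite enum_rankK -/B ZE mul_tensor_rowE => <-.
by rewrite !mxE big_ord1 !mxE mulrC.
Qed.
End Kronecker.

(** * Products in the composition monoid *)

Lemma pkx_ge n k x : (0 < k)%N -> (k * (n * x) <= k * pkx n k x + x)%N.
Proof.
move=> k_gt0; rewrite /pkx; set y : rat := _ * _.
have : y <= (absz (Num.ceil y))%:R.
  by have := lez_abs (Num.ceil y); rewrite ceil_le_int -pmulrn.
move=> hy; rewrite -(ler_nat rat) natrD !natrM.
rewrite -lerBlDr; apply: le_trans (ler_wpM2l (ler0n _ k) hy).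
rewrite /y mulrBl mulrBr mulrA (mulrA _ k%:R^-1) divff ?mul1r //.
by rewrite pnatr_eq0 -lt0n.
Qed.

Lemma empty_mx_eq (K : fieldType) m n (A B : 'M[K]_(m, n)) :
  m = 0%N \/ n = 0%N -> A = B.
Proof.
by case=> e; subst; [rewrite [A]flatmx0 [B]flatmx0|rewrite [A]thinmx0 [B]thinmx0].
Qed.

Section Quiver.
Variables (K : fieldType) (Q : quiver).
Implicit Types (d e : dimvec Q) (i j : vertex Q).

Lemma star_full d e :
    (forall X : rep K (d + e), exists (M : rep K d) g,
      is_hom X M g /\ forall v, row_full (g v)) ->
  star (full_repset K d) (full_repset K e) = full_repset K (d + e).
Proof.
move=> quot; apply: repset_eq => // d' X; split=> [/inset_dim /= ed|].
  by subst d'; exact/(@insetE _ _ (full_repset K (d + e)) _).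
apply: inset_ind => Y _; have [M [g [hg fg]]] := quot Y.
have [N [f [hf fg']]] := ex_ker hg fg (erefl (d + e)).
apply/(@insetE _ _ (star (full_repset K d) (full_repset K e)) _).
by exists M, N; split=> //; exists f, g.
Qed.

(** If no arrow leads from the support of [d + e] to that of [d], any projection
    onto dimension [d] is a morphism to the zero representation. *)
Lemma star_full_disjoint d e :
    (forall a : arrow Q, (d + e) (src a) = 0%N \/ d (tgt a) = 0%N) ->
  star (full_repset K d) (full_repset K e) = full_repset K (d + e).
Proof.
move=> de0; apply: star_full => X.
exists (fun=> 0), (fun v => pid_mx (d v)); split=> [a|v].
  by apply: empty_mx_eq; exact: de0.
by rewrite /row_full rank_pid_mx // ffunE leq_addr.
Qed.

Lemma simple_dimMn i m v : (simple_dim i *+ m) v = ((v == i) * m)%N.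
Proof. by rewrite ffunMnE ffunE; elim: m => [|m IH]; rewrite ?muln0 // mulrS mulnS IH. Qed.

Lemma acyclic_no_loop : acyclic Q -> forall a : arrow Q, src a != tgt a.
Proof.
by move=> acQ a; apply/eqP => e; have := acQ [:: a]; rewrite /= e eqxx => /(_ isT).
Qed.

Lemma narrows_eq0 i j : narrows i j = 0%N ->
  forall a : arrow Q, src a = i -> tgt a <> j.
Proof.
by move=> /card0_eq h a ei ej; have := h a; rewrite !inE ei ej !eqxx.
Qed.

Hypothesis acQ : acyclic Q.

Lemma comp_simpleX i m :
  comp_val (comp_simple K i ^+ m)%g = full_repset K (simple_dim i *+ m).
Proof.
elim: m => [|m IH]; first by rewrite mulr0n.
rewrite expgS /= IH star_full_disjoint ?mulrS // => a.
rewrite ffunE simple_dimMn !ffunE.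
have [es|_] := eqVneq (src a) i; last by left.
by right; rewrite -es eq_sym (negPf (acyclic_no_loop acQ a)).
Qed.

Lemma comp_simpleXX i j m1 m2 : narrows j i = 0%N ->
  comp_val (comp_simple K i ^+ m1 * comp_simple K j ^+ m2)%g =
  full_repset K (simple_dim i *+ m1 + simple_dim j *+ m2).
Proof.
move=> /narrows_eq0 nji; rewrite [LHS]/= !comp_simpleX star_full_disjoint // => a.
rewrite ffunE !simple_dimMn.
have [et|_] := eqVneq (tgt a) i; last by right.
left; have := acyclic_no_loop acQ a; rewrite et => /negPf ->.
have [es|//] := eqVneq (src a) j.
by case: (nji a es et).
Qed.
End Quiver.

(** Only the arrows from [i] to [j] act between nonzero spaces, so that a
    representation of dimension [d + e] is a Kronecker module, and
    [common_quotient] provides a quotient of dimension [d].  The sizes [d v] and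
    [(d + e) v] reduce to [1], [k], [x+1], [k+p] only after [v] is replaced by
    [i] or [j]; [conform_mx] transports matrices across these equalities. *)
Lemma star_full_Kronecker (K : closedFieldType) (Q : quiver) (i j : vertex Q) k x p :
    acyclic Q -> narrows j i = 0%N -> i != j -> (k <= narrows i j)%N ->
    (k * (narrows i j * x - p) <= x)%N ->
  let d := simple_dim i *+ 1 + simple_dim j *+ k in
  let e := simple_dim i *+ x + simple_dim j *+ p in
  star (full_repset K d) (full_repset K e) = full_repset K (d + e).
Proof.
move=> acQ nji neq le_kn le_x d e; apply: star_full => X.
have dE v : d v = ((v == i) + (v == j) * k)%N.
  by rewrite ffunE !simple_dimMn muln1.
have deE v : (d + e) v = ((v == i) * x.+1 + (v == j) * (k + p))%N.
  by rewrite ffunE dE ffunE !simple_dimMn mulnS mulnDr addnACA.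
have [di dj] : d i = 1%N /\ d j = k.
  by rewrite !dE !eqxx (negPf neq) eq_sym (negPf neq) mul0n mul1n.
have [dei dej] : (d + e) i = x.+1 /\ (d + e) j = (k + p)%N.
  by rewrite !deE !eqxx (negPf neq) eq_sym (negPf neq) !mul0n !mul1n addn0.
pose T := {a : arrow Q | (src a == i) && (tgt a == j)}.
pose A (t : T) : 'M[K]_((d + e)%R i, (d + e)%R j) := conform_mx 0 (X (val t)).
have cardT : #|{: T}| = narrows i j by rewrite card_sig.
have [phi [G [c [rphi rG AG]]]] : exists (phi : 'M_((d + e)%R i, d i))
    (G : 'M_((d + e)%R j, d j)) (c : T -> 'M_(d i, d j)),
    [/\ row_full phi, row_full G & forall t, A t *m G = phi *m c t].
  move: (d i) (d j) di dj => _ _ -> ->.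
  have [||||phi [G [c [phi0 rG AG]]]] := @common_quotient K _ _ _ A k.
  - by rewrite cardT.
  - by rewrite dei.
  - by rewrite dej leq_addr.
  - by rewrite cardT dei dej addKn ltnS.
  exists phi, G, c; split=> //.
  by rewrite /row_full eqn_leq rank_leq_col lt0n mxrank_eq0.
pose g v : 'M[K]_((d + e)%R v, d v) :=
  if v == i then conform_mx 0 phi else conform_mx 0 G.
pose M a : 'M[K]_(d (src a), d (tgt a)) :=
  if insub a is Some t then conform_mx 0 (c t) else 0.
exists M, g; split=> [a|v]; last first.
  rewrite /g; have [->|nvi] := eqVneq v i; first by rewrite conform_mx_id.
  have [->|nvj] := eqVneq v j; first by rewrite conform_mx_id.
  have dv : d v = 0%N by rewrite dE (negPf nvi) (negPf nvj).
  by rewrite /row_full eqn_leq rank_leq_col dv.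
rewrite /M; case: insubP => [t /andP[/eqP es /eqP et] ta|nij]; last first.
  apply: empty_mx_eq; rewrite deE dE.
  have := acyclic_no_loop acQ a; have := narrows_eq0 nji (a := a).
  move: nij; case: (eqVneq (src a) i) => [->|_] /=.
    move=> /negPf -> _; rewrite eq_sym => /negPf ->; by right.
  case: (eqVneq (src a) j) => [->|_] /=; last by left.
  move=> _ /(_ erefl) /eqP/negPf ->; rewrite eq_sym => /negPf ->; by right.
have := AG t; rewrite /A ta; move: (X a).
move: (src a) (tgt a) es et => v w -> ->; rewrite /g eqxx eq_sym (negPf neq) => Xa.
by rewrite !conform_mx_id.
Qed.

Local Open Scope group_scope.

Theorem corollary5p6 (K : closedFieldType) (charK0 : [pchar K]%R =i pred0)
    (Q : quiver) (Qacyclic : acyclic Q) (i j : vertex Q)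
    (no_ji : narrows j i = 0%N) (n : nat) (n_def : n = narrows i j)
    (k x : nat) (k_bounds : (1 <= k <= n)%N) (x_ge_k : (k <= x)%N) :
  let R := @comp_simple K Q in
  let p := pkx n k x in
  R i * R j ^+ k * R i ^+ x * R j ^+ p = R i ^+ x.+1 * R j ^+ (p + k).
Proof.
move=> R p; have /andP[k_gt0 le_kn] := k_bounds.
have neq : i != j.
  apply/eqP => ij; move: no_ji le_kn; rewrite n_def ij => ->.
  by rewrite leqNgt k_gt0.
(* Regroup the left-hand side as [(R_i R_j^k) (R_i^x R_j^p)]. *)
apply: comp_val_inj; rewrite comp_simpleXX // -!mulgA mulgA -[R i]expg1.
rewrite [LHS]/= -[star (comp_val (R i ^+ 1)) _]/(comp_val (R i ^+ 1 * R j ^+ k)).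
rewrite -[star (comp_val (R i ^+ x)) _]/(comp_val (R i ^+ x * R j ^+ p)).
rewrite !comp_simpleXX // star_full_Kronecker //.
- congr full_repset; rewrite addrACA -!mulrnDr add1n; congr (_ + _ *+ _)%R.
  exact: addnC.
- by rewrite -n_def.
rewrite -n_def; have := pkx_ge n x k_gt0; rewrite -/p mulnBr; lia.
Qed.
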